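(* Let $k$ be a positive integer. Every continuous $B_k$-equivariant map $$f:V_{k,k}\longrightarrow W_2^+=\bigoplus_{1\le i<j\le k}\mathbb{R}_{\lambda_i+\lambda_j}$$ has a zero.
   Context: The hyperoctahedral group is $B_k=A_k\rtimes S_k$, where $A_k=(\mathbb{Z}/2)^k=\{\pm1\}^k$ and $S_k$ permutes the coordinates. $\mathbb{R}_{\lambda_i+\lambda_j}$ is the one-dimensional real representation of $A_k$ in which $(\epsilon_1,\ldots,\epsilon_k)$ acts by multiplication by $\epsilon_i\epsilon_j$. $W_2^+$ has basis $\{e_{\{i,j\}}\}_{i<j}$ and is a $B_k$-representation in which $A_k$ acts on $e_{\{i,j\}}$ by $\epsilon_i\epsilon_j$ and $\sigma\in S_k$ sends $e_{\{i,j\}}$ to $e_{\{\sigma(i),\sigma(j)\}}$ (no extra signs). $V_{k,k}=\{(u_1,\ldots,u_k)\in(\mathbb{S}^{k-1})^k:\langle u_i,u_j\rangle=\delta_{ij}\}$ is the manifold of orthonormal bases of $\mathbb{R}^k$, on which $A_k$ acts by changing the signs of the vectors and $S_k$ by permuting them. *)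

(* Defs.v *)
From HB Require Import structures.
From mathcomp Require Import all_boot all_order all_algebra all_fingroup.
From mathcomp Require Import all_classical all_reals all_analysis.
Set Implicit Arguments.
Unset Strict Implicit.
Unset Printing Implicit Defensive.
Import Order.TTheory GRing.Theory Num.Theory.
Import numFieldNormedType.Exports.

Local Open Scope ring_scope.

(* [a : 'Z_2] stands for the sign [(-1) ^+ a]. *)
Definition A_ (k : nat) : finGroupType := {dffun forall i : 'I_k, 'Z_2}.

(* All actions are right actions, and [s * t] in ['S_k] is "[s], then [t]";
   this is the left-action convention with products written in reverse. *)
Definition sign_perm (k : nat) (e : A_ k) (s : 'S_k) : A_ k :=
  [ffun i => e ((s^-1)%g i)].

Lemma sign_perm1 (k : nat) : (@sign_perm k)^~ 1%g =1 id.
Proof. by move=> e; apply/ffunP => i; rewrite ffunE invg1 perm1. Qed.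

Lemma sign_permM (k : nat) (e : A_ k) : act_morph (@sign_perm k) e.
Proof. by move=> s t; apply/ffunP => i; rewrite !ffunE invMg permM. Qed.

Definition sign_action (k : nat) := TotalAction (@sign_perm1 k) (@sign_permM k).

Lemma sign_is_groupAction (k : nat) :
  is_groupAction [set: A_ k]%SET (@sign_action k).
Proof.
move=> s _ /=; rewrite inE; apply/andP; split.
  by apply/fintype.subsetP => e _; rewrite inE.
apply/morphicP => d e _ _; rewrite !actpermE /=.
by apply/ffunP => i; rewrite !ffunE.
Qed.

Definition sign_groupAction (k : nat) := GroupAction (@sign_is_groupAction k).

Definition B_ (k : nat) : finGroupType := sdprod_by (@sign_groupAction k).

Definition perm_part (k : nat) (b : B_ k) : 'S_k := (pair_of_sd b).1.
Definition sign_part (k : nat) (b : B_ k) : A_ k := (pair_of_sd b).2.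

Lemma perm_part1 (k : nat) : perm_part (1%g : B_ k) = 1%g.
Proof. by []. Qed.

Lemma sign_part1 (k : nat) : sign_part (1%g : B_ k) = 1%g.
Proof. by []. Qed.

Lemma perm_partM (k : nat) (b c : B_ k) :
  perm_part (b * c)%g = (perm_part b * perm_part c)%g.
Proof. by []. Qed.

Lemma sign_partM (k : nat) (b c : B_ k) :
  sign_part (b * c)%g = (sign_perm (sign_part b) (perm_part c) * sign_part c)%g.
Proof. by []. Qed.

Definition sg (R : realType) (k : nat) (e : A_ k) (i : 'I_k) : R :=
  (-1) ^+ (e i : nat).

Lemma sg1 (R : realType) (k : nat) (i : 'I_k) : sg R (1%g : A_ k) i = 1.
Proof. by rewrite /sg ffunE. Qed.

Lemma sgM (R : realType) (k : nat) (d e : A_ k) (i : 'I_k) :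
  sg R (d * e)%g i = sg R d i * sg R e i.
Proof.
rewrite /sg ffunE -exprD -[RHS]signr_odd -[LHS]signr_odd; congr (_ ^+ _).
by case: (d i) (e i) => [[|[|]] //= ?] [[|[|]] //= ?].
Qed.

Lemma sg_perm (R : realType) (k : nat) (e : A_ k) (s : 'S_k) (i : 'I_k) :
  sg R (sign_perm e s) i = sg R e ((s^-1)%g i).
Proof. by rewrite /sg ffunE. Qed.

(* The rows of [u : 'M_k] are the vectors u_1, ..., u_k. *)
Definition V_ (R : realType) (k : nat) : set 'M[R]_k :=
  [set u | forall i j, \sum_(l < k) u i l * u j l = (i == j)%:R]%classic.

Arguments V_ : clear implicits.

(* Row [perm_part b i] of the result is the row [i] of [u], up to sign. *)
Definition actV_fun (R : realType) (k : nat) (u : 'M[R]_k) (b : B_ k) :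
    'M[R]_k :=
  \matrix_(i, j) (sg R (sign_part b) i * u ((perm_part b)^-1%g i) j).

Lemma actV1 (R : realType) (k : nat) : (@actV_fun R k)^~ 1%g =1 id.
Proof.
by move=> u; apply/matrixP => i j; rewrite mxE sign_part1 sg1 mul1r invg1 perm1.
Qed.

Lemma actVM (R : realType) (k : nat) (u : 'M[R]_k) :
  act_morph (@actV_fun R k) u.
Proof.
move=> b c; apply/matrixP => i j; rewrite !mxE sign_partM perm_partM.
by rewrite sgM sg_perm invMg permM mulrCA mulrA.
Qed.

Definition actV (R : realType) (k : nat) : {action B_ k &-> 'M[R]_k} :=
  TotalAction (@actV1 R k) (@actVM R k).

Arguments actV : clear implicits.

Lemma actV_stable (R : realType) (k : nat) (u : 'M[R]_k) (b : B_ k) :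
  V_ R k u -> V_ R k (actV R k u b).
Proof.
move=> Vu i j; under eq_bigr do rewrite !mxE mulrACA.
rewrite -mulr_sumr Vu (inj_eq perm_inj).
by case: eqVneq => [->|_]; rewrite ?mulr0 // mulr1 /sg -expr2 sqrr_sign.
Qed.

(* The unordered pairs {i, j}, i != j. *)
Definition pairs (k : nat) : finType := {P : {set 'I_k} | #|P| == 2%N}.

Lemma pair_im_subproof (k : nat) (s : 'S_k) (P : pairs k) :
  #|s @: val P| == 2%N.
Proof. by rewrite card_imset ?(valP P) //; apply: perm_inj. Qed.

Definition pair_im (k : nat) (s : 'S_k) (P : pairs k) : pairs k :=
  exist _ (s @: val P) (pair_im_subproof s P).

Definition W2p (R : realType) (k : nat) := 'rV[R]_#|pairs k|.

Arguments W2p : clear implicits.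

Definition basisW (R : realType) (k : nat) (P : pairs k) : W2p R k :=
  delta_mx 0 (enum_rank P).

Definition coordW (R : realType) (k : nat) (w : W2p R k) (P : pairs k) : R :=
  w 0 (enum_rank P).

(* The linear extension of the rule e_P |-> (first s = [perm_part b], then the
   signs) (\prod_(i in s P) eps_i) e_(s P). *)
Definition actW_fun (R : realType) (k : nat) (w : W2p R k) (b : B_ k) :
    W2p R k :=
  \sum_(P : pairs k)
     coordW w P *: (\prod_(i in val (pair_im (perm_part b) P))
                      sg R (sign_part b) i
                    *: basisW R (pair_im (perm_part b) P)).

Lemma sum_coordW (R : realType) (k : nat) (w : W2p R k) :
  w = \sum_(P : pairs k) coordW w P *: basisW R P.
Proof.
rewrite [LHS]row_sum_delta (reindex _ (onW_bij _ (@enum_rank_bij (pairs k)))).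
by [].
Qed.

Lemma coordW_basisW (R : realType) (k : nat) (P Q : pairs k) :
  coordW (basisW R P) Q = (Q == P)%:R.
Proof. by rewrite /coordW mxE eqxx /= (inj_eq enum_rank_inj). Qed.

Lemma actW_basisW (R : realType) (k : nat) (P : pairs k) (b : B_ k) :
  actW_fun (basisW R P) b =
    \prod_(i in val (pair_im (perm_part b) P)) sg R (sign_part b) i
      *: basisW R (pair_im (perm_part b) P).
Proof.
rewrite /actW_fun (bigD1 P) //= coordW_basisW eqxx scale1r [X in _ + X]big1 ?addr0 //.
by move=> Q /negPf QP; rewrite coordW_basisW QP scale0r.
Qed.

Lemma actW_sum (R : realType) (k : nat) (c : pairs k -> R)
    (v : pairs k -> W2p R k) (b : B_ k) :
  actW_fun (\sum_P c P *: v P) b = \sum_P c P *: actW_fun (v P) b.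
Proof.
rewrite /actW_fun.
under [RHS]eq_bigr do rewrite scaler_sumr.
rewrite [RHS]exchange_big /=; apply: eq_bigr => Q _.
rewrite {1}/coordW summxE [LHS]scaler_suml; apply: eq_bigr => P _.
by rewrite mxE [RHS]scalerA.
Qed.

Lemma actW1 (R : realType) (k : nat) : (@actW_fun R k)^~ 1%g =1 id.
Proof.
move=> w; rewrite [RHS]sum_coordW; apply: eq_bigr => P _.
rewrite perm_part1 sign_part1 big1 ?scale1r; last by move=> i _; exact: sg1.
congr (_ *: basisW R _); apply: val_inj => /=.
by rewrite (eq_imset _ (@perm1 _)) imset_id.
Qed.

Lemma actWM (R : realType) (k : nat) (w : W2p R k) :
  act_morph (@actW_fun R k) w.
Proof.
move=> b c; rewrite (sum_coordW w) !actW_sum; apply: eq_bigr => P _.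
congr (_ *: _); rewrite !actW_basisW.
have -> : pair_im (perm_part (b * c)%g) P =
          pair_im (perm_part c) (pair_im (perm_part b) P).
  apply: val_inj; rewrite /= perm_partM -[RHS]imset_comp.
  by apply: eq_imset => i; rewrite /= permM.
set Q := pair_im _ P; set s := perm_part c.
have actZ (a : R) (v : W2p R k) : actW_fun (a *: v) c = a *: actW_fun v c.
  rewrite /actW_fun scaler_sumr; apply: eq_bigr => T _.
  by rewrite [RHS]scalerA /coordW mxE.
rewrite actZ actW_basisW scalerA; congr (_ *: _).
under eq_bigr do rewrite sign_partM sgM sg_perm.
rewrite big_split /=; congr (_ * _).
rewrite big_imset /=; last by move=> ? ? _ _; exact: perm_inj.
by apply: eq_bigr => i _; rewrite permK.
Qed.

Definition actW (R : realType) (k : nat) : {action B_ k &-> W2p R k} :=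
  TotalAction (@actW1 R k) (@actWM R k).

Arguments actW : clear implicits.

(* Main.v *)
(* The number of B_k-orbits of zeros of a generic equivariant map V_{k,k} -> W_2^+ is
   independent of the map modulo 2, because B_k acts freely on V_{k,k}. It is 1 for
   u |-> (<u_i, A u_j>)_{i<j} with A symmetric with simple spectrum, whose zeros are
   the orthonormal eigenbases of A; hence it is never 0.

   Concretely, the zeros of f are those of u |-> (u u^T - 1, f) near V_{k,k} in the
   space of all k x k matrices, which has the dimension of the target. The space is
   triangulated by the barycentric subdivision of a fine cubical grid, which is
   invariant under signed permutations of the rows, and the maps are replaced by
   values at the vertices, perturbed equivariantly into general position. Passing
   from the reference values to those of f one colour of vertices at a time, the
   number of simplices whose image contains the origin changes by an even number in
   a fundamental domain. *)
Require Import Defs.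
From HB Require Import structures.
From mathcomp Require Import all_boot all_order all_algebra all_fingroup.
From mathcomp Require Import all_classical all_reals all_analysis.
From mathcomp Require Import zify ring lra.
Import Order.TTheory GRing.Theory Num.Theory.
Import numFieldNormedType.Exports.
Local Open Scope classical_set_scope.
Local Open Scope ring_scope.
Set Implicit Arguments.
Unset Strict Implicit.
Unset Printing Implicit Defensive.

(** Only the finitely many vertex values enter the parity count, so the reference map may jump where
    it passes from [quad] to its linearization. Its zero has to be moved off the identity matrix,
    which is itself a grid vertex, to the barycenter of a simplex: there it survives small
    perturbations.

    An equivariant perturbation cannot be chosen independently at all vertices. Since the action is
    free near [V_], it can be prescribed at one representative of each orbit and transported from
    there.

    The colour of a vertex is its index in the simplex, which the symmetries preserve. While the
    values of colour [c] are replaced, a simplex is selected if its vertex of colour [c] represents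
    its orbit. Passing to the neighbour across a facet that contains this vertex does not affect the
    condition, so the pairing of facets stays inside the fundamental domain.

    Simplices at the border of the region do not spoil the pairing: there some entry of [u u^T - 1]
    has a constant sign, and both maps share this entry. *)

Lemma odd_card_involution (T : finType) (A : {set T}) (h : T -> T) :
  (forall x, x \in A -> h x \in A) -> (forall x, x \in A -> h x != x) ->
  (forall x, x \in A -> h (h x) = x) -> ~~ odd #|A|.
Proof.
have [n le_n] := ubnP #|A|; elim: n A le_n => // n IHn A le_n hA hx hh.
have [->|[x xA]] := set_0Vmem A; first by rewrite cards0.
have Ex : #|A| = (#|A :\ x :\ h x|).+2.
  by rewrite (cardsD1 x) xA (cardsD1 (h x) (A :\ x)) !inE hx // hA.
rewrite Ex /= negbK; apply: IHn.
- by move: le_n; rewrite Ex ltnS; apply: leq_trans.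
- move=> y; rewrite !inE => /and3P[yhx yx yA]; rewrite hA // andbT.
  apply/andP; split; first by apply: contra yx => /eqP e; rewrite -(hh y) // e hh.
  by apply: contra yhx => /eqP e; rewrite -e hh.
- by move=> y; rewrite !inE => /and3P[_ _]; apply: hx.
- by move=> y; rewrite !inE => /and3P[_ _]; apply: hh.
Qed.

(** * Facets containing the origin, for vectors in general position *)

Section Zero.
Variable R : realType.

(* Strict positivity is harmless: for vectors in general position a nontrivial
   dependency with nonnegative coefficients cannot have a zero coefficient. *)
Definition zero_in (V : lmodType R) (m : nat) (v : 'I_m -> V) : Prop :=
  exists2 c : 'I_m -> R, (forall i, 0 < c i) & \sum_i c i *: v i = 0.

Lemma eq_zero_in (V : lmodType R) (m : nat) (v w : 'I_m -> V) :
  v =1 w -> zero_in v <-> zero_in w.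
Proof. by move=> /funext->. Qed.

Definition generic (n : nat) (v : 'I_n.+2 -> 'rV[R]_n) : Prop :=
  forall h : 'I_n -> 'I_n.+2, injective h -> \det (\matrix_i v (h i)) != 0.

Section EvenFacets.
Variables (n : nat) (v : 'I_n.+2 -> 'rV[R]_n).
Hypothesis gv : generic v.

Let dep (d : 'I_n.+2 -> R) := \sum_i d i *: v i = 0.

Let skip2 (a b : 'I_n.+2) : a != b ->
  exists b' : 'I_n.+1, b = lift a b' /\ forall V (F : 'I_n.+2 -> 'rV[R]_V),
    \sum_i F i = F a + F b + \sum_i F (lift a (lift b' i)).
Proof.
move=> ab; have [b' e1 e2] := unlift_some ab; exists b'; split=> // V F.
by rewrite (bigD1_ord a) //= -addrA (bigD1_ord b') //= -e1.
Qed.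

Let skip2_unit a b' : \matrix_i v (lift a (lift b' i)) \in unitmx.
Proof. by rewrite unitmxE unitfE gv // => i j /lift_inj/lift_inj. Qed.

Let dep0 d a b : a != b -> dep d -> d a = 0 -> d b = 0 -> forall i, d i = 0.
Proof.
move=> ab dd da db i; have [b' [Eb sumE]] := skip2 ab.
move: dd; rewrite /dep sumE da db !scale0r !add0r => dd.
have d0 : \row_i d (lift a (lift b' i)) = 0.
  apply: (row_free_inj (A := \matrix_i v (lift a (lift b' i)))).
    by rewrite row_free_unit skip2_unit.
  rewrite mul0mx mulmx_sum_row -[RHS]dd; apply: eq_bigr => j _.
  by rewrite mxE rowK.
have [<-//|ai] := eqVneq a i; have [i' Ei _] := unlift_some ai.
move: d0; have [Eib|bi] := eqVneq b' i'; first by rewrite Ei -Eib -Eb.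
have [i2 Ei2 _] := unlift_some bi.
by move/rowP/(_ i2); rewrite !mxE Ei Ei2.
Qed.

Let dep_ex a b : a != b -> exists2 d, dep d & d a = 1.
Proof.
move=> ab; have [b' [Eb sumE]] := skip2 ab.
pose M := \matrix_i v (lift a (lift b' i)); pose c := - v a *m invmx M.
pose d i := if unlift a i is Some i' then
  if unlift b' i' is Some i2 then c 0 i2 else 0 else 1.
exists d; last by rewrite /d unlift_none.
rewrite /dep sumE /d unlift_none Eb liftK unlift_none scale1r scale0r addr0.
have : c *m M = - v a by rewrite mulmxKV ?skip2_unit.
rewrite mulmx_sum_row => cM; apply/eqP; rewrite addrC addr_eq0 -cM; apply/eqP.
by apply: eq_bigr => i _; rewrite !liftK rowK.
Qed.

Let facetP a : zero_in (fun i => v (lift a i)) <->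
  exists2 d, dep d & d a = 0 /\ forall i, i != a -> 0 < d i.
Proof.
split=> [[c c0 cv]|[d dd [da d0]]].
  pose d i := if unlift a i is Some i' then c i' else 0.
  exists d.
    rewrite /dep (bigD1_ord a) //= {1}/d unlift_none scale0r add0r -[RHS]cv.
    by apply: eq_bigr => i _; rewrite /d liftK.
  split=> [|i]; rewrite /d; first by rewrite unlift_none.
  by rewrite eq_sym => /unlift_some[j -> ->].
exists (fun i => d (lift a i)); first by move=> i; rewrite d0 // eq_sym neq_lift.
by move: dd; rewrite /dep (bigD1_ord a) //= da scale0r add0r.
Qed.

Let dep_lin d e x y : dep d -> dep e -> dep (fun i => x * d i + y * e i).
Proof.
rewrite /dep => dd de; under eq_bigr do rewrite scalerDl -!scalerA.
by rewrite big_split /= -!scaler_sumr dd de !scaler0 addr0.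
Qed.

(* The nonnegative dependencies between [n.+2] vectors in general position in
   dimension [n] form the origin or a planar cone; in the second case its two
   extreme rays are the two facets containing the origin. *)
Lemma even_facets :
  ~~ odd #|[set a | `[< zero_in (fun i => v (lift a i)) >]]%SET|.
Proof.
set Z := [set a | _]%SET; have [->|[a]] := set_0Vmem Z; first by rewrite cards0.
rewrite inE => /asboolP/facetP[p dp [pa p0]].
have [b0 ab0] : exists b, b != a by exists (lift a ord0); rewrite eq_sym neq_lift.
have [q dq qa] : exists2 q, dep q & q a = 1 by apply: (@dep_ex a b0); rewrite eq_sym.
have [b ba bmax] : exists2 b, b != a &
    forall j, j != a -> - q j / p j <= - q b / p b.
  have [b ba bmax] := @arg_maxP _ R _ b0 (fun j => j != a) (fun j => - q j / p j) ab0.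
  by exists b.
(* The largest ratio [- q j / p j] is the least multiple of [p] that makes [q] nonnegative off [a].
   It is attained at [b], so [z] vanishes there and is the second extreme ray. *)
pose z i := 1 * q i + (- q b / p b) * p i.
have dz : dep z by apply: dep_lin.
have zb : z b = 0 by rewrite /z mul1r divfK ?subrr // gt_eqF // p0.
have za : z a = 1 by rewrite /z mul1r qa pa mulr0 addr0.
have z0 j : j != a -> j != b -> 0 < z j.
  move=> ja jb; rewrite lt_neqAle; apply/andP; split.
    apply/eqP => zj; have := oner_neq0 R; rewrite -za.
    by rewrite (dep0 jb dz) ?eqxx.
  by rewrite /z mul1r addrC -[q j]opprK subr_ge0 -ler_pdivrMr ?bmax ?p0.
suff -> : Z = [set a; b]%SET by rewrite cards2 eq_sym ba.
apply/setP => c; rewrite !inE; apply/asboolP/orP; last first.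
  case=> /eqP->; apply/facetP; first by exists p.
  exists z; rewrite // zb; split=> // i ib.
  by have [->|ia] := eqVneq i a; rewrite ?za ?z0.
move=> /facetP[y dy [yc y0]]; have [|ca] := eqVneq c a; [by left | right].
have ya : 0 < y a by rewrite y0 // eq_sym.
(* No third facet [c] is possible: [y], scaled to agree with [z] at [a], differs from [z] by a
   multiple of [p]. The value at [b] shows that the multiple is nonnegative, yet [w] is negative at
   [c]. *)
pose w i := (y a)^-1 * y i + (-1) * z i.
have dw : dep w by apply: dep_lin.
have wa : w a = 0 by rewrite /w mulVf ?za ?mulr1 ?subrr // gt_eqF.
pose s := w b / p b.
have wE i : w i = s * p i.
  pose e i := 1 * w i + (- s) * p i.
  have : e i = 0.
    apply: (@dep0 e a b); rewrite 1?eq_sym //; first exact: dep_lin.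
      by rewrite /e wa pa !mulr0 addr0.
    by rewrite /e /s mul1r mulNr divfK ?subrr // gt_eqF // p0.
  by rewrite /e mul1r mulNr => /eqP; rewrite subr_eq0 => /eqP.
have s_ge0 : 0 <= s.
  rewrite divr_ge0 ?(ltW (p0 b ba)) // /w zb mulr0 addr0.
  rewrite mulr_ge0 ?invr_ge0 ?(ltW ya) //.
  by have [->|bc] := eqVneq b c; rewrite ?yc // ltW ?y0.
apply/negP => /negP cb.
have : w c < 0 by rewrite /w yc mulr0 add0r mulN1r oppr_lt0 z0.
by rewrite wE ltNge mulr_ge0 // ltW ?p0.
Qed.

End EvenFacets.
End Zero.

(** * Parity of the number of zeros *)

Section Parity.
Variables (R : realType) (n : nat) (S : finType) (X : {set S}).
Variables (FD : 'I_n.+1 -> {set S}) (nu : 'I_n.+1 -> S -> S).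
Variable (vl : bool -> 'I_n.+1 -> S -> 'rV[R]_n).

Definition hybrid (j : nat) (x : S) (i : 'I_n.+1) := vl (i < j)%N i x.

Definition pos_of (c : 'I_n.+1) (m : 'I_n.+2) : 'I_n.+1 := inord (unbump c m).

(* The two versions of vertex [c], together with the other vertices of a mixed
   simplex; deleting one or the other version of [c] gives the consecutive
   [hybrid]s, as in the standard triangulation of a prism. *)
Definition prism (c : 'I_n.+1) (x : S) (m : 'I_n.+2) :=
  vl (m <= c)%N (pos_of c m) x.

Hypothesis FD_sub : forall c x, x \in FD c -> x \in X.
Hypothesis nuK : forall i x, x \in X -> nu i (nu i x) = x.
Hypothesis nu_neq : forall i x, x \in X -> nu i x != x.
Hypothesis nu_val : forall b i j x, x \in X -> j != i -> vl b j (nu i x) = vl b j x.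
Hypothesis nu_FD : forall c i x, c != i ->
  nu i x \in X -> x \in FD c -> nu i x \in FD c.
Hypothesis prism_generic : forall c x, x \in X -> generic (prism c x).
Hypothesis prism_boundary : forall c x m, x \in X -> pos_of c m != c ->
  nu (pos_of c m) x \notin X -> ~ zero_in (fun i => prism c x (lift m i)).
Hypothesis count_FD : forall j c d,
  #|[set x in FD c | `[< zero_in (hybrid j x) >]]%SET| =
  #|[set x in FD d | `[< zero_in (hybrid j x) >]]%SET|.

Lemma pos_ofE c m : pos_of c m = unbump c m :> nat.
Proof. by rewrite inordK // /unbump; have := ltn_ord m; have := ltn_ord c; lia. Qed.

Lemma prism_face_lo c x i : prism c x (lift (inord c) i) = hybrid c x i.
Proof.
have Ec : (inord c : 'I_n.+2) = c :> nat by rewrite inordK // ltnS ltnW.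
rewrite /prism /hybrid; have -> : pos_of c (lift (inord c) i) = i.
  by apply: ord_inj; rewrite pos_ofE /= Ec bumpK.
by congr vl; rewrite /= Ec /bump; lia.
Qed.

Lemma prism_face_hi c x i : prism c x (lift (lift ord0 c) i) = hybrid c.+1 x i.
Proof.
rewrite /prism /hybrid; have -> : pos_of c (lift (lift ord0 c) i) = i.
  by apply: ord_inj; rewrite pos_ofE /= /bump /unbump; lia.
by congr vl; rewrite /= /bump; lia.
Qed.

Lemma pos_of_lift c m a : pos_of c m != c -> pos_of c (lift m a) != pos_of c m.
Proof.
move=> mc; move: mc (neq_lift m a); rewrite -!(inj_eq val_inj) /= !pos_ofE /=.
by rewrite /unbump /bump; lia.
Qed.

Let face c m x := `[< zero_in (fun i => prism c x (lift m i)) >].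

(** The deleted vertex is not a copy of [c], so its index [i] labels no other vertex of the prism.
    Hence [nu i] leaves the facet unchanged and pairs the simplices of [FD c]; where it would leave
    [X], [prism_boundary] excludes a zero. *)
Lemma odd_face c m : pos_of c m != c -> ~~ odd #|[set x in FD c | face c m x]%SET|.
Proof.
move=> mc; set i := pos_of c m.
have key x : x \in FD c -> face c m x -> nu i x \in X.
  move=> xF /asboolP zx; apply/negPn/negP => nX.
  exact: (prism_boundary (FD_sub xF) mc nX).
have face_nu x : x \in FD c -> face c m (nu i x) = face c m x.
  move=> xF; apply: asbool_equiv_eq; apply: eq_zero_in => a.
  rewrite /prism nu_val ?FD_sub //; first exact: FD_sub xF.
  exact: pos_of_lift.
apply: (@odd_card_involution _ _ (nu i)) => x; rewrite !inE => /andP[xF zx].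
- rewrite face_nu // zx andbT; apply: nu_FD => //; first by rewrite eq_sym.
  exact: key.
- by apply: nu_neq; apply: FD_sub xF.
- by apply: nuK; apply: FD_sub xF.
Qed.

Lemma odd_step c :
  odd #|[set x in FD c | `[< zero_in (hybrid c x) >]]%SET| =
  odd #|[set x in FD c | `[< zero_in (hybrid c.+1 x) >]]%SET|.
Proof.
have E1 : [set x in FD c | `[< zero_in (hybrid c x) >]]%SET =
    [set x in FD c | face c (inord c) x]%SET.
  apply/setP => x; rewrite !inE; congr andb; apply: asbool_equiv_eq.
  by apply: eq_zero_in => i; rewrite prism_face_lo.
have E2 : [set x in FD c | `[< zero_in (hybrid c.+1 x) >]]%SET =
    [set x in FD c | face c (lift ord0 c) x]%SET.
  apply/setP => x; rewrite !inE; congr andb; apply: asbool_equiv_eq.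
  by apply: eq_zero_in => i; rewrite prism_face_hi.
(* Double counting: with the sums exchanged, every prism contributes an even number by
   [even_facets]. *)
have total : ~~ odd (\sum_(m < n.+2) #|[set x in FD c | face c m x]%SET|).
  under eq_bigr do rewrite -sum1dep_card.
  under eq_bigr do rewrite big_mkcondr.
  rewrite exchange_big /=.
  apply: (big_ind (fun k => ~~ odd k)) => // [a b|x xF].
    by rewrite oddD => /negPf-> /negPf->.
  rewrite -big_mkcond /= sum1dep_card.
  exact: (even_facets (prism_generic c (FD_sub xF))).
have cd : (lift ord0 c : 'I_n.+2) != inord c.
  by rewrite -(inj_eq val_inj) /= inordK /bump ?ltnS ?(ltnW (ltn_ord c)) //; lia.
move: total; rewrite E1 E2 (bigD1 (inord c)) //= (bigD1 (lift ord0 c)) //=.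
rewrite !oddD.
have -> : odd (\sum_(i < n.+2 | (i != inord c) && (i != lift ord0 c))
    #|[set x in FD c | face c i x]%SET|) = false.
  apply/negbTE; apply: (big_ind (fun k => ~~ odd k)) => // [a b|m /andP[m1 m2]].
    by rewrite oddD => /negPf-> /negPf->.
  apply: odd_face; move: m1 m2.
  rewrite -!(inj_eq val_inj) /= pos_ofE inordK ?ltnS ?(ltnW (ltn_ord c)) //.
  by rewrite /unbump /bump; lia.
by rewrite addbF; case: odd; case: odd.
Qed.

(* Replacing the values one vertex index at a time, every prism has an even number
   of zero facets, and the facets deleting another vertex are matched by [nu]. *)
Theorem odd_zero_count (c : 'I_n.+1) :
  odd #|[set x in FD c | `[< zero_in (fun i => vl false i x) >]]%SET| =
  odd #|[set x in FD c | `[< zero_in (fun i => vl true i x) >]]%SET|.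
Proof.
have step j : (j <= n.+1)%N ->
    odd #|[set x in FD c | `[< zero_in (hybrid 0 x) >]]%SET| =
    odd #|[set x in FD c | `[< zero_in (hybrid j x) >]]%SET|.
  elim: j => // j IHj jn; rewrite IHj ?(ltnW jn) //.
  (* Step [j] has to be counted in the domain of the vertex [j] being replaced; [count_FD] passes to
     it and back. *)
  rewrite (count_FD _ c (Ordinal jn)) (odd_step (Ordinal jn)).
  by rewrite (count_FD _ _ c).
rewrite -[LHS]/(odd #|[set x in FD c | `[< zero_in (hybrid 0 x) >]]%SET|).
rewrite (step n.+1) //; congr (odd _); apply: eq_card => x; rewrite !inE; congr andb.
apply: asbool_equiv_eq; apply: eq_zero_in => i.
by rewrite /hybrid ltn_ord.
Qed.

End Parity.

(** * General position *)

Section GeneralPosition.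
Variable R : realType.

(** A line through a point outside [U] meets [U] at most once, and not at parameter [0]. *)
Lemma near_avoid (V : vectType R) (U : {vspace V}) (v u : V) :
  v \notin U -> \forall x \near 0^'+, v + x *: u \notin U.
Proof.
move=> vU; have [[a aU]|noa] := pselect (exists a, v + a *: u \in U); last first.
  by near=> x; apply/negP => xU; apply: noa; exists x.
have ne x : x != a -> v + x *: u \notin U.
  move=> xa; apply: contra vU => xU.
  have uU : u \in U.
    rewrite -[u]scale1r -(mulVf (_ : x - a != 0)) ?subr_eq0 // -scalerA memvZ //.
    have -> : (x - a) *: u = (v + x *: u) - (v + a *: u).
      by rewrite opprD addrACA subrr add0r scalerBl.
    exact: memvB.
  by rewrite -[v](addrK (x *: u)) memvB // memvZ.
have [a0|a0] := leP a 0.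
  by near=> x; apply: ne; rewrite gt_eqF // (le_lt_trans a0).
by near=> x; apply: ne; rewrite lt_eqF //; near: x; exact: nbhs_right_lt.
Unshelve. all: by end_near. Qed.

Lemma avoid_subspaces (V : vectType R) (Us : seq {vspace V}) :
  (forall U, U \in Us -> U != fullv) -> exists v, forall U, U \in Us -> v \notin U.
Proof.
elim: Us => [_|U Us IH UsP]; first by exists 0.
have [|v vP] := IH; first by move=> W WUs; rewrite UsP // inE WUs orbT.
have /subvPn[u _ uU] : ~~ (fullv <= U)%VS.
  by have := UsP U (mem_head _ _); rewrite eqEsubv subvf.
have [vU|vU] := boolP (v \in U); last first.
  by exists v => W; rewrite inE => /predU1P[->|/vP].
have : \forall x \near 0^'+, forall W, W \in Us -> v + x *: u \notin W.
  elim: Us vP {IH UsP} => [|W Us IH] vP; first by near=> x.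
  have {}IH : \forall x \near 0^'+, forall W', W' \in Us -> v + x *: u \notin W'.
    by apply: IH => W' W'Us; apply: vP; rewrite inE W'Us orbT.
  have hW := near_avoid u (vP W (mem_head _ _)).
  apply: filterS2 hW IH => x xW xUs W'.
  by rewrite inE => /predU1P[->|/xUs].
move=> H; have [x [xP x0]] := filter_ex (filterI H (nbhs_right_gt (0 : R))).
exists (v + x *: u) => W; rewrite inE => /predU1P[->|/xP//].
apply: contra uU => xU; rewrite -[u]scale1r -(mulVf (lt0r_neq0 x0)) -scalerA memvZ //.
by rewrite -[_ *: u](addKr v) memvD // memvN.
Unshelve. all: by end_near. Qed.

Section Family.
Variables (n : nat) (G : finType) (rho : G -> 'M[R]_n).
Hypothesis rho_unit : forall g, rho g \in unitmx.

Let moved (y : nat -> 'rV[R]_n) (g : nat -> G) j := y j *m rho (g j).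

Lemma free_family (m : nat) : exists y : nat -> 'rV[R]_n,
  forall (s : seq nat) (g : nat -> G), uniq s -> all (fun j => j < m)%N s ->
    (size s <= n)%N -> free (map (moved y g) s).
Proof.
elim: m => [|m [y yP]].
  by exists (fun=> 0) => -[|//] g _ _ _; rewrite /= nil_free.
pose sub (A : {set 'I_m}) (g : {ffun 'I_m -> G}) (h : G) : {vspace 'rV[R]_n} :=
  <<[seq y i *m rho (g i) *m invmx (rho h) | i : 'I_m <- enum A]>>%VS.
pose Us := [seq sub a.1.1 a.1.2 a.2 |
  a : {set 'I_m} * {ffun 'I_m -> G} * G <-
    enum [pred a : {set 'I_m} * {ffun 'I_m -> G} * G | (#|a.1.1| < n)%N]].
have [U|v vP] := @avoid_subspaces _ Us.
  case/mapP => -[[A g] h]; rewrite mem_enum inE /= => An ->; apply/eqP => e.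
  have := dim_span [seq y i *m rho (g i) *m invmx (rho h) | i : 'I_m <- enum A].
  rewrite -/(sub A g h) e dimvf /dim /= mul1n size_map -cardE.
  by rewrite leqNgt An.
pose y' j := if (j < m)%N then y j else v.
have y'E g s : all (fun j => j < m)%N s -> map (moved y' g) s = map (moved y g) s.
  by move/allP => sm; apply/eq_in_map => j /sm /= jm; rewrite /moved /y' jm.
have free_v s g : uniq s -> all (fun j => j < m)%N s -> (size s < n)%N ->
    free (map (moved y' g) (m :: s)).
  move=> us sm sn /=; rewrite free_cons y'E // yP ?(ltnW sn) // andbT.
  rewrite /moved /y' ltnn.
  pose A := [set i : 'I_m | val i \in s]%SET.
  have mapA : perm_eq s [seq nat_of_ord i | i : 'I_m <- enum A].
    apply: uniq_perm => // [|j].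
      by rewrite map_inj_uniq ?enum_uniq //; exact: val_inj.
    apply/idP/mapP => [js|[i]]; last by rewrite mem_enum inE => ? ->.
    by have jm := allP sm _ js; exists (Ordinal jm); rewrite ?mem_enum ?inE.
  have : v \notin sub A [ffun i => g (val i)] (g m).
    apply: vP; apply/mapP; exists (A, [ffun i => g (val i)], g m) => //=.
    by rewrite mem_enum inE /= cardE -(size_map val) -(perm_size mapA).
  apply: contra => vs; rewrite -[v](mulmxK (rho_unit (g m))).
  have -> : sub A [ffun i => g (val i)] (g m) =
      <<[seq x *m invmx (rho (g m)) | x <- map (moved y g) s]>>%VS.
    apply/eq_span => x; rewrite -map_comp.
    apply/mapP/mapP => [[i]|[j js ->]].
      by rewrite mem_enum inE => iS ->; exists (val i); rewrite //= /moved ffunE.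
    have jm := allP sm _ js; exists (Ordinal jm); rewrite ?mem_enum ?inE //= ffunE //.
  move: (map (moved y g) s) (v *m _) vs => X w wX.
  rewrite [w](@coord_span _ _ _ (in_tuple X) w wX) mulmx_suml memv_suml // => i _.
  rewrite -scalemxAl memvZ // memv_span //.
  by apply: (map_f (fun x => x *m _)); rewrite mem_nth.
exists y' => s g us sm sn; have [ms|ms] := boolP (m \in s).
  have ps := perm_to_rem ms.
  rewrite (perm_free (perm_map _ ps)); apply: free_v; first exact: rem_uniq.
    apply/allP => j; rewrite mem_rem_uniq // !inE => /andP[jm js].
    by have := allP sm _ js; rewrite /= ltnS leq_eqVlt (negPf jm).
  by rewrite size_rem // prednK // -has_predT; apply/hasP; exists m.
have {}sm : all (fun j => j < m)%N s.
  apply/allP => j js; have := allP sm _ js; rewrite /= ltnS leq_eqVlt.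
  by move=> /predU1P[ej|//]; rewrite ej (negPf ms) in js.
by rewrite y'E ?yP.
Qed.

Lemma det_family (J : finType) : exists y : J -> 'rV[R]_n,
  forall (h : 'I_n -> J) (g : 'I_n -> G), injective h ->
    \det (\matrix_i (y (h i) *m rho (g i))) != 0.
Proof.
have [y yP] := free_family #|J|; exists (fun j => y (enum_rank j)) => h g hI.
have h'I : injective (fun i => nat_of_ord (enum_rank (h i))).
  by move=> i j /ord_inj/enum_rank_inj/hI.
apply/negP => /det0P[v v0 vM]; case/eqP: v0; apply/rowP => i0; rewrite mxE.
(* As [h] is injective, [g] extends to a choice indexed by [nat]; the default is never met on the
   indices of the family. *)
pose g' j := g (odflt i0 [pick i | nat_of_ord (enum_rank (h i)) == j]).
have g'E i : g' (enum_rank (h i)) = g i.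
  rewrite /g'; case: pickP => [i' /eqP/h'I->//|/(_ i)]; by rewrite eqxx.
have fr : free [seq moved y g' (enum_rank (h i)) | i : 'I_n <- enum 'I_n].
  rewrite (map_comp (moved y g')); apply: yP.
  - by rewrite map_inj_uniq ?enum_uniq.
  - by apply/allP => j /mapP[i _ ->] /=.
  - by rewrite size_map -cardE card_ord.
have sz : size [seq moved y g' (enum_rank (h i)) | i : 'I_n <- enum 'I_n] == n.
  by rewrite size_map -cardE card_ord.
have /freeP/(_ (fun i => v 0 i)) := fr : free (Tuple sz).
apply; rewrite -[RHS]vM mulmx_sum_row; apply: eq_bigr => j _.
rewrite rowK /= (nth_map i0) ?size_enum_ord //.
by rewrite nth_ord_enum /moved g'E.
Qed.

End Family.

Lemma near_horner_neq0 (p : {poly R}) : p != 0 -> \forall t \near 0^'+, p.[t] != 0.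
Proof.
have [d] := ubnP (size p); elim: d p => // d IHd p pd p0.
have [[a pa]|nor] := pselect (exists a, root p a); last first.
  by near=> t; apply/negP => pt; apply: nor; exists t.
have [q Ep] := factor_theorem _ _ pa.
have q0 : q != 0 by apply: contraNneq p0 => q0; rewrite Ep q0 mul0r.
have hq : \forall t \near 0^'+, q.[t] != 0.
  apply: (IHd _ _ q0); move: pd; rewrite Ep size_Mmonic ?monicXsubC //.
  by rewrite size_XsubC addn2 ltnS.
have hta : \forall t \near 0^'+, t != a.
  have [a0|a0] := leP a 0; first by near=> t; rewrite gt_eqF // (le_lt_trans a0).
  by near=> t; rewrite lt_eqF //; near: t; exact: nbhs_right_lt.
near=> t; rewrite Ep hornerM hornerXsubC mulf_neq0 ?subr_eq0 //.
  by near: t.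
by near: t.
Unshelve. all: by end_near. Qed.

(** [B + t Y] is singular only if [t] is an eigenvalue of [- B Y^-1], that is, a root of a nonzero
    polynomial. *)
Lemma near_det_neq0 (n : nat) (B Y : 'M[R]_n) : \det Y != 0 ->
  \forall t \near 0^'+, \det (B + t *: Y) != 0.
Proof.
move=> dY; have uY : Y \in unitmx by rewrite unitmxE unitfE.
have := near_horner_neq0 (monic_neq0 (char_poly_monic (- (B *m invmx Y)))).
apply: filterS => t; rewrite -rootE -eigenvalue_root_char => ev.
apply: contra ev => /det0P[v v0]; rewrite mulmxDr => /eqP; rewrite addr_eq0 => /eqP vB.
apply/eigenvalueP; exists v => //.
by rewrite mulmxN mulmxA vB -scalemxAr mulNmx opprK -scalemxAl mulmxK.
Qed.

End GeneralPosition.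

(** * The hyperoctahedral group *)

Section Symmetry.
Variables (R : realType) (k : nat).
Implicit Types (P Q X u : 'M[R]_k) (b c : B_ k).

Definition eps b i : R := sg R (sign_part b) i.
Definition iperm b i := ((perm_part b)^-1)%g i.

Lemma eps1 i : eps 1%g i = 1. Proof. exact: sg1. Qed.
Lemma iperm1 i : iperm 1%g i = i. Proof. by rewrite /iperm invg1 perm1. Qed.
Lemma epsM b c i : eps (b * c)%g i = eps b (iperm c i) * eps c i.
Proof. by rewrite /eps sign_partM sgM sg_perm. Qed.
Lemma ipermM b c i : iperm (b * c)%g i = iperm b (iperm c i).
Proof. by rewrite /iperm perm_partM invMg permM. Qed.
Lemma eps_cases b i : (eps b i == 1) || (eps b i == -1).
Proof. by rewrite /eps /sg -signr_odd; case: odd; rewrite /= ?expr0 ?expr1 eqxx ?orbT. Qed.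
Lemma eps_sq b i : eps b i * eps b i = 1.
Proof. by case/orP: (eps_cases b i) => /eqP->; rewrite ?mulrNN mulr1. Qed.
Lemma norm_eps b i : `|eps b i| = 1.
Proof. by case/orP: (eps_cases b i) => /eqP->; rewrite ?normrN normr1. Qed.
Lemma iperm_inj b : injective (iperm b). Proof. exact: perm_inj. Qed.

Lemma actVE u b i j : actV R k u b i j = eps b i * u (iperm b i) j.
Proof. by rewrite mxE. Qed.

Lemma B_eq1 b : (forall i, iperm b i = i) -> (forall i, eps b i = 1) -> b = 1%g.
Proof.
move=> h1 h2; apply: val_inj; rewrite [LHS]surjective_pairing /=.
congr (_, _).
  rewrite -[LHS]invgK; apply/eqP; rewrite eq_invg1; apply/eqP/permP => i.
  by rewrite perm1; exact: h1.
apply/ffunP => i; rewrite ffunE; have := h2 i; rewrite /eps /sg /sign_part.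
set x : 'Z_2 := _ i; rewrite -/x; case: x => [[|[|]] //= lt2 e].
  exact: val_inj.
by move/eqP: e; rewrite expr1 -subr_eq0 -opprD oppr_eq0 -[1 + 1]/(2%:R) pnatr_eq0.
Qed.

Definition conjB P b : 'M[R]_k :=
  \matrix_(i, j) (eps b i * eps b j * P (iperm b i) (iperm b j)).

Lemma conjB1 P : conjB P 1%g = P.
Proof. by apply/matrixP => i j; rewrite mxE !eps1 !iperm1 !mul1r. Qed.

Lemma conjBM P b c : conjB P (b * c)%g = conjB (conjB P b) c.
Proof. by apply/matrixP => i j; rewrite !mxE !epsM !ipermM; ring. Qed.

Lemma conjB_sym P b : P^T = P -> (conjB P b)^T = conjB P b.
Proof.
move=> sP; apply/matrixP => i j; rewrite !mxE -{1}sP mxE.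
by rewrite [eps b j * _]mulrC.
Qed.

Lemma conjB_one b : conjB 1%:M b = 1%:M.
Proof.
apply/matrixP => i j; rewrite !mxE (inj_eq (@iperm_inj b)).
by case: eqVneq => [->|_]; rewrite ?mulr0 // eps_sq mulr1.
Qed.

Lemma conjB_sub P Q b : conjB (P - Q) b = conjB P b - conjB Q b.
Proof. by apply/matrixP => i j; rewrite !mxE mulrBr. Qed.

Lemma actV_form u (A : 'M[R]_k) b :
  actV R k u b *m A *m (actV R k u b)^T = conjB (u *m A *m u^T) b.
Proof.
apply/matrixP => i j; rewrite !mxE mulr_sumr; apply: eq_bigr => l _.
rewrite [RHS]mulrAC !mxE -!/(eps _ _) -!/(iperm _ _).
rewrite !(mulr_suml, mulr_sumr); apply: eq_bigr => h _.
by rewrite !mxE -!/(eps _ _) -!/(iperm _ _); ring.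
Qed.

(* The target, symmetric matrices times [W2p], has the same dimension [k * k] as
   the ambient space: a pair [(P, Q)] of symmetric matrices is stored with [P] on
   and above the diagonal and [Q] below it, so the diagonal of [Q] is dropped. *)
Definition mix P Q : 'M[R]_k :=
  \matrix_(i, j) if (i <= j)%N then P i j else Q i j.
Definition up X : 'M[R]_k := \matrix_(i, j) if (i <= j)%N then X i j else X j i.
Definition lo X : 'M[R]_k := \matrix_(i, j) if (i <= j)%N then X j i else X i j.

Definition actC X b := mix (conjB (up X) b) (conjB (lo X) b).

Lemma up_sym X : (up X)^T = up X.
Proof.
apply/matrixP => i j; rewrite !mxE; case: ltngtP => // /ord_inj ->//.
Qed.
Lemma lo_sym X : (lo X)^T = lo X.
Proof. by apply/matrixP => i j; rewrite !mxE; case: ltngtP => // /ord_inj ->. Qed.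
Lemma mix_up_lo X : mix (up X) (lo X) = X.
Proof. by apply/matrixP => i j; rewrite !mxE; case: leqP. Qed.

Lemma actC_mix P Q b : P^T = P -> Q^T = Q ->
  actC (mix P Q) b = mix (conjB P b) (conjB Q b).
Proof.
move=> sP sQ; apply/matrixP => i j; rewrite !mxE.
have [ij|ij] := leqP i j; congr (_ * _).
  by case: leqP => // ji; rewrite -[in RHS]sP mxE // (ltnW ji).
(* A permutation keeps off-diagonal positions off the diagonal, so the dropped diagonal of [Q] is
   never read. *)
have : iperm b i != iperm b j by rewrite (inj_eq (@iperm_inj b)) -(inj_eq val_inj) gtn_eqF.
move: (iperm b i) (iperm b j) => i' j'; rewrite -(inj_eq val_inj) /= => ne.
by case: ltngtP ne => // ij' _; rewrite -[in RHS]sQ mxE.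
Qed.

Lemma actC1 X : actC X 1%g = X.
Proof. by rewrite /actC !conjB1 mix_up_lo. Qed.

Lemma actCM X b c : actC X (b * c)%g = actC (actC X b) c.
Proof.
by rewrite [in RHS]/actC -/(actC _ c) actC_mix ?conjB_sym ?up_sym ?lo_sym // -!conjBM.
Qed.

Definition actCr b X := actC X b.

Lemma actC_is_linear b : linear (actCr b).
Proof.
move=> a X Y; apply/matrixP => i j; rewrite !mxE.
by case: ifP => _; case: ifP => _; ring.
Qed.

HB.instance Definition _ b :=
  GRing.isLinear.Build R 'M[R]_k 'M[R]_k _ (actCr b) (@actC_is_linear b).

Definition rho b : 'M[R]_(k * k) :=
  lin1_mx (fun x : 'rV[R]_(k * k) => mxvec (actCr b (vec_mx x))).

Lemma mul_rho X b : mxvec X *m rho b = mxvec (actC X b).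
Proof.
rewrite (mul_rV_lin1 [the {linear 'rV[R]_(k * k) -> 'rV[R]_(k * k)} of
  mxvec \o actCr b \o vec_mx]).
by rewrite /= mxvecK.
Qed.

Lemma rho_unit b : rho b \in unitmx.
Proof.
have : rho b *m rho b^-1%g = 1%:M.
  apply/row_matrixP => i; rewrite !rowE mulmx1 mulmxA -[delta_mx _ _]vec_mxK.
  by rewrite !mul_rho -actCM mulgV actC1.
by case/mulmx1_unit.
Qed.

(** As a symmetric matrix with zero diagonal ([insub] fails exactly when [i = j]), [w] is acted on
    by [conjB], like the Gram matrix. *)
Definition coordM (w : W2p R k) : 'M[R]_k :=
  \matrix_(i, j) if insub [set i; j]%SET is Some p then coordW w p else 0.

Lemma coordM_sym w : (coordM w)^T = coordM w.
Proof. by apply/matrixP => i j; rewrite !mxE finset.setUC. Qed.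

Lemma coordW_actW w b p : coordW (actW R k w b) p =
  (\prod_(i in val p) eps b i) * coordW w (pair_im (perm_part b)^-1%g p).
Proof.
have inv_im p' : pair_im (perm_part b) (pair_im (perm_part b)^-1%g p') = p'.
  apply: val_inj => /=; rewrite -imset_comp -[RHS]imset_id.
  by apply: eq_imset => i /=; rewrite permKV.
have inv_im' p' : pair_im (perm_part b)^-1%g (pair_im (perm_part b) p') = p'.
  apply: val_inj => /=; rewrite -imset_comp -[RHS]imset_id.
  by apply: eq_imset => i /=; rewrite permK.
rewrite {1}/coordW /= /actW_fun summxE.
rewrite (bigD1 (pair_im (perm_part b)^-1%g p)) //= [X in _ + X]big1 ?addr0.
  rewrite inv_im !mxE -/(coordW _ _) eqxx (inj_eq enum_rank_inj) eqxx mulr1.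
  by have /= -> := congr1 val (inv_im p); rewrite mulrC.
move=> p' np; rewrite !mxE eqxx (inj_eq enum_rank_inj).
case: eqVneq => [e|_]; last by rewrite !mulr0.
by rewrite -[p']inv_im' -e eqxx in np.
Qed.

Lemma coordM_actW w b : coordM (actW R k w b) = conjB (coordM w) b.
Proof.
apply/matrixP => i j; rewrite !mxE.
have im : [set iperm b i; iperm b j]%SET =
    [set ((perm_part b)^-1)%g x | x in [set i; j]]%SET.
  by rewrite finset.imsetU1 finset.imset_set1.
case: insubP => [p _ Ep|]; last first.
  case: insubP => [q|_ _]; last by rewrite mulr0.
  by rewrite im card_imset => [->//|]; exact: perm_inj.
have ij : i != j.
  have : #|[set i; j]%SET| == 2%N by rewrite -Ep; exact: (valP p).
  by rewrite cards2 eqSS eqb1.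
rewrite coordW_actW Ep finset.big_setU1 ?inE //= finset.big_set1; congr (_ * _).
have -> : insub [set iperm b i; iperm b j]%SET = Some (pair_im (perm_part b)^-1%g p).
  by rewrite im -Ep; exact: (valK (pair_im (perm_part b)^-1%g p)).
by [].
Qed.

Lemma coordM_neq0 w : w != 0 -> exists i j : 'I_k, (j < i)%N /\ coordM w i j != 0.
Proof.
move=> w0; have [p wp] : exists p, coordW w p != 0.
  apply/existsP; apply: contraNT w0; rewrite negb_exists => /forallP w0.
  rewrite (sum_coordW w) big1 // => p _.
  by have /negPn/eqP-> := w0 p; rewrite scale0r.
have := valP p; case/cards2P => i [j [ij Ep]].
wlog ji : i j ij Ep / (j < i)%N.
  move=> H; case: (ltngtP j i) => [h|h|e]; first exact: (H i j).
    by apply: (H j i) => //; rewrite 1?eq_sym // finset.setUC.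
  by rewrite (ord_inj e) eqxx in ij.
exists i, j; split=> //; rewrite mxE -Ep.
by rewrite (valK p).
Qed.

End Symmetry.

(** * An equivariant triangulation *)

Section Cells.
Variables (R : realType) (m n : nat).

(* A simplex of the barycentric subdivision of the cubical grid [Z^n] starts at an
   even lattice point and then moves each coordinate by one unit, one coordinate
   after the other. A cell [(w, s, p)] records one coordinate of it: the start
   [2 (w - m)], the direction (negative if [s]) and the time [p] of the move. *)
Definition cell : finType := ('I_m.*2.+1 * bool * 'I_n)%type.
Implicit Types x y : cell.

Definition cell_coord x (i : nat) : R :=
  (x.1.1%:R - m%:R) * 2 + (-1) ^+ x.1.2 * (x.2 < i)%N%:R.

Lemma cell_coord_dist x i j : `|cell_coord x i - cell_coord x j| <= 1.
Proof.
rewrite /cell_coord opprD addrACA subrr add0r -mulrBr normrM normr_sign mul1r.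
by do 2 case: (_ < _)%N; rewrite ?subrr ?subr0 ?sub0r ?normrN ?normr1 ?normr0.
Qed.

(** Vertex [0] determines the start, vertex [n] the direction, and the first index where the
    coordinate has changed the time. *)
Lemma cell_coord_inj x y : (forall i, (i <= n)%N -> cell_coord x i = cell_coord y i) -> x = y.
Proof.
case: x y => [[w s] p] [[w' s'] p'] h.
have := h 0 (leq0n n); rewrite /cell_coord /= !mulr0 !addr0.
have n2 : (2 : R) != 0 by rewrite pnatr_eq0.
move=> /(mulIf n2)/addIr/eqP; rewrite eqr_nat => /eqP/ord_inj ew.
move: h; rewrite -{}ew => h.
have es : s = s'.
  have := h n (leqnn n); rewrite /cell_coord /= !ltn_ord !mulr1 => /addrI.
  case: s s' {h} => -[] //= /eqP; rewrite expr0 expr1 ?[1 == _]eq_sym;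
    by rewrite -subr_eq0 -opprD oppr_eq0 (negPf n2).
move: h; rewrite -{}es => h.
suff -> : p = p' by [].
have {}h i : (i <= n)%N -> (p < i)%N = (p' < i)%N.
  move=> /h; rewrite /cell_coord /= => /addrI/(mulfI (negbT (signr_eq0 R s)))/eqP.
  by rewrite eqr_nat; do 2 case: (_ < i)%N.
apply/ord_inj/eqP; rewrite eqn_leq.
have := h _ (ltn_ord p); rewrite ltnSn ltnS => <-.
by have := h _ (ltn_ord p'); rewrite ltnSn ltnS => ->.
Qed.

Definition flip_cell (e : bool) x : cell :=
  if e then (rev_ord x.1.1, ~~ x.1.2, x.2) else x.

Lemma cell_coord_flip e x i : cell_coord (flip_cell e x) i = (-1) ^+ e * cell_coord x i.
Proof.
case: e; last by rewrite expr0 mul1r.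
rewrite expr1 /cell_coord /= signrN.
have le : (x.1.1 <= m.*2)%N by rewrite -ltnS.
have E : (m.*2)%:R = m%:R + m%:R :> R by rewrite -addnn natrD.
by rewrite subSS natrB // E; ring.
Qed.

(** The transposition of the times [i.-1] and [i]; the default of [insubd] can occur only for [i] at
    least [n]. *)
Definition swap_pos (i : nat) (p : 'I_n) : 'I_n :=
  insubd p (if p == i.-1 :> nat then i else if p == i :> nat then i.-1 else p).

Lemma swap_posE i p : (0 < i < n)%N -> swap_pos i p =
  (if p == i.-1 :> nat then i else if p == i :> nat then i.-1 else p) :> nat.
Proof.
move=> hi; rewrite /swap_pos val_insubd.
by case: ifP => //; case: ifP; [|case: ifP]; have := ltn_ord p; lia.
Qed.

(* The other simplex containing the facet opposite to vertex [i]. At the border of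
   the grid [ordS] and [ord_pred] wrap around, whence the bound in [cell_coord_pivot]. *)
Definition pivot_cell (i : nat) x : cell :=
  if i == 0 then
    if x.2 == 0 :> nat then
      (if x.1.2 then ord_pred x.1.1 else ordS x.1.1, ~~ x.1.2, x.2)
    else x
  else if i == n then
    if x.2 == n.-1 :> nat then (x.1.1, ~~ x.1.2, x.2) else x
  else (x.1.1, x.1.2, swap_pos i x.2).

Lemma pivot_cellK i x : (i <= n)%N -> pivot_cell i (pivot_cell i x) = x.
Proof.
case: x => [[w s] p] i_n; rewrite /pivot_cell.
have [_|i0] := eqVneq i 0.
  case: (eqVneq (nat_of_ord p) 0) => [p0|/negPf p0]; rewrite /= ?p0 //= negbK.
  by case: s => /=; rewrite ?p0 ?ordSK ?ord_predK.
have [_|ni] := eqVneq i n.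
  by case: (eqVneq (nat_of_ord p) n.-1) => [p0|/negPf p0]; rewrite /= ?p0 ?eqxx ?negbK //=.
have hi : (0 < i < n)%N by rewrite lt0n i0 ltn_neqAle ni.
congr (_, _, _); apply: ord_inj; rewrite /= !swap_posE //.
case: (nat_of_ord p =P i.-1) => ?; [|case: (nat_of_ord p =P i) => ?];
  do ?[case: eqP => ? //=]; lia.
Qed.

Lemma pivot_cell_pos i x : (pivot_cell i x).2 = if (0 < i < n)%N then swap_pos i x.2 else x.2.
Proof.
rewrite /pivot_cell; case: eqVneq => [->|i0]; first by case: ifP.
case: eqVneq => [->|ni]; first by rewrite ltnn andbF; case: ifP.
case: ifP => //= hi; apply: ord_inj; rewrite /swap_pos val_insubd.
have := ltn_ord x.2.
case: (nat_of_ord x.2 =P i.-1) => ?; [|case: (nat_of_ord x.2 =P i) => ?];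
  by case: ifP; lia.
Qed.

Lemma swap_pos_inj i : (0 < i < n)%N -> injective (swap_pos i).
Proof.
move=> hi p p' /(congr1 (@nat_of_ord n)); rewrite !swap_posE // => e.
by apply: ord_inj; move: e; do ![case: eqP => ? //=]; lia.
Qed.

Lemma pivot_cell_pos_inj i x y : (pivot_cell i x).2 = (pivot_cell i y).2 -> x.2 = y.2.
Proof. by rewrite !pivot_cell_pos; case: ifP => // hi /(swap_pos_inj hi). Qed.

Lemma cell_coord_pivot i j x : (i <= n)%N -> (j <= n)%N -> j != i ->
  `|cell_coord x j| < (m.*2.+1)%:R -> cell_coord (pivot_cell i x) j = cell_coord x j.
Proof.
case: x => [[w s] p] i_n j_n ji bnd; rewrite /pivot_cell.
have [i0|i0] := eqVneq i 0.
  case: (eqVneq (nat_of_ord p) 0) => [p0|//]; rewrite /=.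
  have j0 : (0 < j)%N by lia.
  move: bnd; rewrite /cell_coord /= p0 j0 !mulr1.
  have wle := ltn_ord w.
  case: s => /=; rewrite ?expr0 ?expr1.
    (* For [w = 0] and a negative direction the coordinate is [- (2 m + 1)], which the bound
       excludes: [ord_pred] does not wrap. The case of [ordS] below is symmetric. *)
    case: (posnP w) => [w0|w0] bnd.
      move: bnd; rewrite w0 -addnn -addn1 !natrD ltr_norml; lra.
    have -> : ((w + m.*2.+1).-1 %% m.*2.+1)%N = w.-1.
      by rewrite -subn1 addnC -addnBA // addnC modnDr modn_small; lia.
    by rewrite -subn1 natrB //; ring.
  case: (ltnP w m.*2) => [w0|w0] bnd.
    by rewrite modn_small ?ltnS // -addn1 natrD; ring.
  have ew : nat_of_ord w = m.*2 by lia.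
  by move: bnd; rewrite ew -addnn -addn1 !natrD ltr_norml; lra.
have [ni|ni] := eqVneq i n.
  case: (eqVneq (nat_of_ord p) n.-1) => [p0|//]; rewrite /cell_coord /=.
  have -> : (p < j)%N = false by rewrite p0; lia.
  by rewrite !mulr0.
have hi : (0 < i < n)%N by rewrite lt0n i0 ltn_neqAle ni.
rewrite /cell_coord /= swap_posE //; congr (_ + _ * _%:R).
by do ![case: eqP => ? //=]; lia.
Qed.

Lemma pivot_cell_neq i x : (i <= n)%N -> (0 < n)%N ->
  x.2 = i.-1 :> nat -> pivot_cell i x != x.
Proof.
case: x => [[w s] p] /= i_n n0 pi; rewrite /pivot_cell /=.
have sN : forall w', (w', ~~ s, p) == (w, s, p) :> cell = false.
  by move=> w'; rewrite !xpair_eqE; case: s; rewrite ?andbF.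
have [i0|i0] := eqVneq i 0; first by rewrite pi i0 /= sN.
have [ni|ni] := eqVneq i n; first by rewrite pi ni eqxx sN.
rewrite !xpair_eqE !eqxx /= -(inj_eq (@ord_inj n)) swap_posE ?pi ?eqxx; lia.
Qed.

End Cells.

(** * Simplices in the space of matrices and the simplex at the identity *)

Section Simplices.
Variables (R : realType) (k m q : nat).
Hypothesis q_gt0 : (0 < q)%N.
Local Notation n := (k * k)%N.

Definition simplex : finType := 'M[cell m n]_k.
Implicit Types (x y : simplex) (b : B_ k).

(** The scaling turns even lattice points into multiples of [1/q]. For [m = 2 q] the starting points
    fill the box of radius [2], which contains every matrix with Gram matrix close to [1]. *)
Definition vert x (i : nat) : 'M[R]_k := \matrix_(a, c) (cell_coord R (x a c) i / (2 * q)%:R).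
(** There are as many entries as times, so each step then moves exactly one entry; only such
    matrices of cells describe simplices. *)
Definition pos_inj x : bool :=
  injectiveb (fun d : 'I_k * 'I_k => (x d.1 d.2).2).
Definition actS x b : simplex :=
  \matrix_(a, c) flip_cell (eps R b a != 1) (x (iperm b a) c).
Definition pivot (i : nat) x : simplex := map_mx (pivot_cell i) x.

Let q2_gt0 : 0 < (2 * q)%:R :> R. Proof. by rewrite ltr0n muln_gt0. Qed.
Let q2_neq0 : (2 * q)%:R != 0 :> R. Proof. exact: lt0r_neq0. Qed.

Lemma vert_actS x b i : vert (actS x b) i = actV R k (vert x i) b.
Proof.
apply/matrixP => a c; rewrite actVE !mxE cell_coord_flip mulrA; congr (_ * _ * _).
case/orP: (eps_cases R b a) => /eqP->; rewrite ?eqxx ?expr0 //.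
by rewrite -subr_eq0 -opprD oppr_eq0 -[1 + 1]/(2%:R) pnatr_eq0 expr1.
Qed.

Lemma vert_inj x y : (forall i, (i <= n)%N -> vert x i = vert y i) -> x = y.
Proof.
move=> h; apply/matrixP => a c; apply: (@cell_coord_inj R) => i /h/matrixP/(_ a c).
by rewrite !mxE => /(mulIf (invr_neq0 q2_neq0)).
Qed.

Lemma vert_dist x i j a c : `|vert x i a c - vert x j a c| <= (2 * q)%:R^-1.
Proof.
rewrite !mxE -mulrBl normrM normfV (gtr0_norm q2_gt0).
by rewrite ler_piMl ?invr_ge0 ?(ltW q2_gt0) ?cell_coord_dist.
Qed.

Lemma pos_inj_actS x b : pos_inj x -> pos_inj (actS x b).
Proof.
move=> /injectiveP xI; apply/injectiveP => -[a c] [a' c'] /=; rewrite !mxE.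
have fl e (z : cell m n) : (flip_cell e z).2 = z.2 by case: e.
rewrite !fl => e.
have [/iperm_inj-> ->//] : (iperm b a, c) = (iperm b a', c').
by apply: xI.
Qed.

Lemma pos_inj_pivot i x : pos_inj x -> pos_inj (pivot i x).
Proof.
move=> /injectiveP xI; apply/injectiveP => -[a c] [a' c'] /=; rewrite !mxE.
by move=> /pivot_cell_pos_inj e; apply: xI.
Qed.

Lemma pivotK i x : (i <= n)%N -> pivot i (pivot i x) = x.
Proof. by move=> ?; apply/matrixP => a c; rewrite !mxE pivot_cellK. Qed.

Lemma pos_surj x (p : 'I_n) : pos_inj x -> exists a c, (x a c).2 = p.
Proof.
move=> /injectiveP xI; have := inj_card_bij xI.
rewrite card_prod !card_ord leqnn => /(_ isT)[g _ gK].
by exists (g p).1, (g p).2; rewrite gK.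
Qed.

Lemma pivot_neq i x : (0 < k)%N -> (i <= n)%N -> pos_inj x -> pivot i x != x.
Proof.
move=> k0 i_n xI; have n0 : (0 < n)%N by rewrite muln_gt0 k0.
have i1_n : (i.-1 < n)%N by case: (i) i_n.
have [a [c e]] := pos_surj (Ordinal i1_n) xI.
apply/eqP => /matrixP/(_ a c); rewrite mxE; apply/eqP; apply: pivot_cell_neq => //.
by rewrite e.
Qed.

Lemma vert_pivot i j x : (i <= n)%N -> (j <= n)%N -> j != i -> (2 * q <= m)%N ->
  (forall a c, `|vert x j a c| < 2) -> vert (pivot i x) j = vert x j.
Proof.
move=> i_n j_n ji qm bnd; apply/matrixP => a c; rewrite !mxE cell_coord_pivot //.
have := bnd a c; rewrite mxE normrM normfV (gtr0_norm q2_gt0) ltr_pdivrMr //.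
move=> /lt_le_trans; apply; rewrite -natrM ler_nat; lia.
Qed.

(** It starts at the identity matrix and increases the entries in the order of [mxvec_index]; the
    reference map gets its zero at its barycenter. *)
Definition std : simplex :=
  \matrix_(a, c) (inord (m + q * (a == c)), false, mxvec_index a c).

Hypothesis q_le_m : (q <= m)%N.

Lemma cell_coord_std a c i :
  cell_coord R (std a c) i = (2 * q)%:R * (a == c)%:R + (mxvec_index a c < i)%N%:R.
Proof.
rewrite mxE /cell_coord /= inordK; last by case: (a == c); lia.
by rewrite expr0 mul1r natrD !natrM; ring.
Qed.

Lemma vert_std a c i :
  vert std i a c = (a == c)%:R + (mxvec_index a c < i)%N%:R / (2 * q)%:R.
Proof. by rewrite mxE cell_coord_std mulrDl mulrAC mulfV // mul1r. Qed.

Definition barycenter : 'M[R]_k := n.+1%:R^-1 *: \sum_(j < n.+1) vert std j.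

(** The fraction of the vertices of [std] at which the entry of index [p] has already moved. That it
    lies strictly between [0] and [1] and decreases strictly in [p] says that the barycenter is
    interior. *)
Definition theta (p : nat) : R := (n - p)%N%:R / n.+1%:R.

Lemma barycenterE a c : barycenter a c = (a == c)%:R + theta (mxvec_index a c) / (2 * q)%:R.
Proof.
rewrite mxE summxE; under eq_bigr do rewrite vert_std.
rewrite big_split /= -mulr_suml sumr_const card_ord -natr_sum.
have -> N p : (\sum_(j < N) (p < j) = N.-1 - p)%N.
  by elim: N => [|N IH]; rewrite ?big_ord0 // big_ord_recr /= IH; lia.
rewrite /theta /= -[(_ == _)%:R *+ _]mulr_natr mulrDr; congr (_ + _).
  by rewrite mulrCA mulVf ?mulr1 // pnatr_eq0.
by rewrite mulrA [_^-1 * _]mulrC.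
Qed.

Lemma theta_gt0 (p : 'I_n) : 0 < theta p.
Proof. by rewrite divr_gt0 ?ltr0n // subn_gt0. Qed.

Lemma theta_lt1 p : theta p < 1.
Proof. by rewrite ltr_pdivrMr ?ltr0n // mul1r ltr_nat ltnS leq_subr. Qed.

Lemma theta_anti (p p' : 'I_n) : (p < p')%N -> theta p' < theta p.
Proof.
move=> pp; rewrite ltr_pM2r ?invr_gt0 ?ltr0n // ltr_nat.
by have := ltn_ord p'; lia.
Qed.

Lemma mono_ord_id (N : nat) (h : 'I_N -> 'I_N) :
  {mono h : i j / (i < j)%N} -> forall i, h i = i.
Proof.
move=> hm i; have hI : injective h.
  move=> a b e; apply/ord_inj/eqP; have := hm a b; have := hm b a.
  by rewrite e ltnn; case: ltngtP.
have cnt (j : 'I_N) : #|[set l : 'I_N | (l < j)%N]%SET| = j.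
  rewrite -sum1dep_card -(big_ord_widen _ (fun=> 1%N)) ?(ltnW (ltn_ord j)) //.
  by rewrite sum1_card card_ord.
apply: ord_inj; rewrite -[LHS]cnt -[RHS]cnt.
rewrite -[RHS](card_imset _ hI); apply: eq_card => l; rewrite inE.
have [g gK hK] := injF_bij hI.
apply/idP/imsetP => [li|[j]]; last by rewrite inE -hm => ? ->.
by exists (g l); rewrite ?hK // inE -hm hK.
Qed.

(* If the barycenter of [std] is not in [x], some barycentric coordinate of [x] is
   negative there; its linear part is a coordinate or a difference of two. *)
Lemma separate_barycenter x : pos_inj x -> x != std ->
  exists chi : 'cV[R]_n, forall j, (j <= n)%N ->
    0 < (mxvec (vert x j - barycenter) *m chi) 0 0.
Proof.
move=> xI; pose Y (a c : 'I_k) : R := (2 * q)%:R * (a == c)%:R + theta (mxvec_index a c).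
have diffE j a c : (vert x j - barycenter) a c = (cell_coord R (x a c) j - Y a c) / (2 * q)%:R.
  rewrite mxE [(- barycenter) a c]mxE barycenterE mxE /Y mulrBl.
  rewrite [(_ + theta _) / _]mulrDl; congr (_ - (_ + _)).
  by rewrite mulrAC mulfV ?mul1r.
have one a c (e : R) : (forall j, (j <= n)%N -> 0 < e * (cell_coord R (x a c) j - Y a c)) ->
    exists chi : 'cV[R]_n, forall j, (j <= n)%N ->
    0 < (mxvec (vert x j - barycenter) *m chi) 0 0.
  move=> h; exists (e *: delta_mx (mxvec_index a c) 0) => j /h h'.
  rewrite -scalemxAr mxE -colE mxE mxvecE diffE mulrA.
  by rewrite divr_gt0.
have q1 : 1 <= (2 * q)%:R :> R by rewrite ler1n; lia.
(* A different start is at least [2] away in grid units, while the simplex strays by at most [1] and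
   [theta] lies in the open unit interval: this coordinate separates. *)
move=> xs; have [[a [c wac]]|/forallNP wE] :=
    pselect (exists a c, (x a c).1.1 != (m + q * (a == c))%N :> nat).
  have t0 := theta_gt0 (mxvec_index a c); have t1 := theta_lt1 (mxvec_index a c).
  have : ((x a c).1.1.+1 <= m + q * (a == c))%N || ((m + q * (a == c)).+1 <= (x a c).1.1)%N.
    by case: ltngtP wac.
  have sb j : -1 <= ((-1) ^+ (x a c).1.2 * ((x a c).2 < j)%N%:R : R) <= 1.
    rewrite -ler_norml normrM normr_sign mul1r.
    by case: (_ < j)%N; rewrite ?normr1 ?normr0 ?ler01.
  case/orP; rewrite -(ler_nat R) -addn1 !natrD natrM => w.
    by apply: (one a c (-1)) => j _; have /andP[] := sb j; rewrite /cell_coord /Y natrM; lra.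
  by apply: (one a c 1) => j _; have /andP[] := sb j; rewrite /cell_coord /Y natrM; lra.
have {}wE a c : (x a c).1.1 = (m + q * (a == c))%N :> nat.
  by apply/eqP/negPn/negP => h; apply: (wE a); exists c.
have czE a c j : cell_coord R (x a c) j =
    (2 * q)%:R * (a == c)%:R + (-1) ^+ (x a c).1.2 * ((x a c).2 < j)%N%:R.
  by rewrite /cell_coord wE natrD !natrM; ring.
have [[a [c sac]]|/forallNP sE] := pselect (exists a c, (x a c).1.2).
  apply: (one a c (-1)) => j _; have t0 := theta_gt0 (mxvec_index a c).
  by rewrite czE sac /Y expr1; case: (_ < j)%N; rewrite ?mulr0n ?mulr1n; lra.
have {}sE a c : (x a c).1.2 = false.
  by apply/negP => h; apply: (sE a); exists c.
(* Two entries moved in the wrong order: the difference of their coordinates is nonnegative on [x]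
   and negative at the barycenter, after subtracting the start. Without such a pair the order is
   that of [std]. *)
have [[a [c [a' [c' [pp ii]]]]]|inv] := pselect (exists a c a' c',
    ((x a c).2 < (x a' c').2)%N /\ (mxvec_index a' c' < mxvec_index a c)%N).
  exists (delta_mx (mxvec_index a c) 0 - delta_mx (mxvec_index a' c') 0) => j _.
  rewrite mulmxBr -!colE !mxE !mxvecE !diffE -mulrBl divr_gt0 //.
  have := theta_anti ii; rewrite !czE !sE /Y expr0 !mul1r => tt.
  have : ((x a' c').2 < j)%N%:R <= ((x a c).2 < j)%N%:R :> R.
    by rewrite ler_nat; lia.
  by lra.
case/eqP: xs; apply/matrixP => a c; rewrite mxE.
have pE : (x a c).2 = mxvec_index a c.
  have inv' a1 c1 a2 c2 : (mxvec_index a1 c1 < mxvec_index a2 c2)%N ->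
      ((x a1 c1).2 < (x a2 c2).2)%N.
    move=> h; rewrite ltnNge leq_eqVlt; apply/negP => /orP[/eqP/ord_inj e|h'].
      have [e1 e2] : (a2, c2) = (a1, c1) by apply: (injectiveP _ xI).
      by rewrite e1 e2 ltnn in h.
    by apply: inv; exists a2, c2, a1, c1.
  pose h (d : 'I_n) :=
    let e := enum_val (cast_ord (esym (mxvec_cast k k)) d) in (x e.1 e.2).2.
  have hE a1 c1 : h (mxvec_index a1 c1) = (x a1 c1).2.
    by rewrite /h /mxvec_index cast_ordK enum_rankK.
  rewrite -hE; apply: mono_ord_id => d d'.
  case/mxvec_indexP: d => a1 c1; case/mxvec_indexP: d' => a2 c2; rewrite !hE.
  apply/idP/idP => [|]; last exact: inv'.
  move=> lt; rewrite ltnNge; apply/negP.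
  rewrite leq_eqVlt => /orP[/eqP/ord_inj/(congr1 h)|/inv']; rewrite ?hE => e.
    by rewrite e ltnn in lt.
  by have := ltn_trans lt e; rewrite ltnn.
rewrite [LHS]surjective_pairing [X in (X, _)]surjective_pairing pE sE.
congr (_, _, _); apply: ord_inj; rewrite wE inordK //.
by case: (a == c); lia.
Qed.

End Simplices.

(** * Compactness and quadratic maps *)

Section Compactness.
Variables (R : realType) (k : nat).
Implicit Types (u v : 'M[R]_k) (e d : R).

Definition close_mx e u v := forall a c, `|u a c - v a c| < e.

Lemma close_sym e u v : close_mx e u v -> close_mx e v u.
Proof. by move=> h a c; rewrite distrC. Qed.

Lemma close_mxW e d u v : e <= d -> close_mx e u v -> close_mx d u v.
Proof. by move=> ed h a c; exact: lt_le_trans (h a c) ed. Qed.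

Lemma close_trans e d u v x : close_mx e u v -> close_mx d v x -> close_mx (e + d) u x.
Proof.
by move=> h1 h2 a c; rewrite (le_lt_trans (ler_distD (v a c) _ _)) // ltrD.
Qed.

Lemma close_act e u v b : close_mx e u v -> close_mx e (actV R k u b) (actV R k v b).
Proof. by move=> h a c; rewrite !actVE -mulrBr normrM norm_eps mul1r. Qed.

Definition bounded_by (M : R) u := forall a c, `|u a c| <= M.

(** A Lebesgue number argument on a compact box. Since [P] also depends on [d], the uniform radius
    can itself appear as a bound in the conclusion. *)
Lemma uniform_on_box (P : R -> 'M[R]_k -> Prop) (M : R) :
  (forall u, bounded_by M u -> exists2 e, 0 < e &
     forall v d, close_mx e u v -> 0 < d < e -> P d v) ->
  exists2 e, 0 < e & forall v d, bounded_by M v -> 0 < d < e -> P d v.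
Proof.
move=> loc; pose K : set 'rV[R]_(k * k) := [set x | forall i, `[- M, M]%classic (x ord0 i)].
have Kc : compact K.
  by apply: (@rV_compact R (k * k) (fun=> `[- M, M]%classic)) => i; exact: segment_compact.
have KM x : K x <-> bounded_by M (vec_mx x).
  split=> [h a c|h i].
    by rewrite mxE ler_norml; have := h (mxvec_index a c); rewrite /= in_itv.
  case/mxvec_indexP: i => a c; rewrite /= in_itv /= -ler_norml.
  by have := h a c; rewrite mxE.
have /compact_near_coveringP/(_ R (0 : R)^'+ (fun d x => P d (vec_mx x)) _) := Kc.
case.
  move=> x /KM/loc[e e0 eP]; exists (ball x e, [set d | 0 < d < e]) => /=.
    split; first exact: nbhsx_ballx.
    apply: filterS2 (nbhs_right_gt 0) (nbhs_right_lt e0) => d /= -> //.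
  move=> [x' d] /= [[_ xx'] de]; apply: eP => // a c.
  by rewrite !mxE; exact: xx'.
move=> e /= e0 eP; exists e => // v d vM /andP[d0 de].
have Kv : K (mxvec v) by apply/KM; rewrite mxvecK.
have := eP d _ d0 (mxvec v) Kv; rewrite mxvecK; apply.
by rewrite /ball_ /= sub0r normrN gtr0_norm.
Qed.

Definition qform (weight : 'I_k -> R) u : 'M[R]_k :=
  \matrix_(i, j) \sum_l weight l * (u i l * u j l).

Lemma qformE weight u : qform weight u = u *m diag_mx (\row_l weight l) *m u^T.
Proof.
apply/matrixP => i j; rewrite mul_mx_diag !mxE; apply: eq_bigr => l _.
by rewrite !mxE; ring.
Qed.

Lemma qform_sym weight u : (qform weight u)^T = qform weight u.
Proof.
apply/matrixP => i j; rewrite !mxE; apply: eq_bigr => l _.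
by rewrite [u j l * _]mulrC.
Qed.

Lemma qform_actV weight u b : qform weight (actV R k u b) = conjB (qform weight u) b.
Proof. by rewrite !qformE actV_form. Qed.

Lemma qform_lip weight (M : R) : exists2 C, 0 < C & forall u v e, 0 < e ->
  bounded_by M u -> bounded_by M v -> close_mx e u v -> close_mx (C * e) (qform weight u) (qform weight v).
Proof.
pose S := \sum_l `|weight l|; have S0 : 0 <= S by apply: sumr_ge0.
exists (S * (`|M| + `|M|) + 1) => [|u v e e0 uM vM uv a c].
  by rewrite ltr_wpDl // mulr_ge0 // addr_ge0.
have MM : M <= `|M| by exact: ler_norm.
rewrite !mxE -sumrB; apply: le_lt_trans (ler_norm_sum _ _ _) _.
apply: (@le_lt_trans _ _ (S * (`|M| + `|M|) * e)); last by rewrite ltr_pM2r // ltrDl.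
rewrite -mulrA mulr_suml; apply: ler_sum => l _; rewrite -mulrBr normrM ler_wpM2l //.
have -> : u a l * u c l - v a l * v c l =
  (u a l - v a l) * u c l + v a l * (u c l - v c l) by ring.
apply: le_trans (ler_normD _ _) _; rewrite !normrM mulrDl lerD //.
  by rewrite mulrC ler_pM // ?(le_trans (uM _ _)) // ltW.
by rewrite ler_pM // ?(le_trans (vM _ _)) // ltW.
Qed.

Definition gram1 u := qform (fun=> 1) u - 1%:M.

Lemma gram1_V u : V_ R k u <-> gram1 u = 0.
Proof.
split=> [Vu|/matrixP u0 i j].
  apply/matrixP => i j; rewrite !mxE -(Vu i j).
  by apply/eqP; rewrite subr_eq0; apply/eqP/eq_bigr => l _; rewrite mul1r.
have := u0 i j; rewrite !mxE => /eqP; rewrite subr_eq0 => /eqP <-.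
by apply: eq_bigr => l _; rewrite mul1r.
Qed.

Lemma gram1_sym u : (gram1 u)^T = gram1 u.
Proof. by rewrite /gram1 linearB /= qform_sym tr_scalar_mx. Qed.

Lemma gram1_actV u b : gram1 (actV R k u b) = conjB (gram1 u) b.
Proof. by rewrite /gram1 qform_actV conjB_sub conjB_one. Qed.

Lemma gram1_lip (M : R) : exists2 C, 0 < C & forall u v e, 0 < e ->
  bounded_by M u -> bounded_by M v -> close_mx e u v -> close_mx (C * e) (gram1 u) (gram1 v).
Proof.
have [C C0 CP] := qform_lip (fun=> 1) M; exists C => // u v e e0 uM vM uv a c.
have := CP u v e e0 uM vM uv a c; congr (`|_| < _).
by rewrite !mxE; ring.
Qed.

(** Each row has squared norm below [2]. *)
Lemma bounded_of_gram u c : c <= 1 -> close_mx c (gram1 u) 0 -> forall a l, `|u a l| < 2.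
Proof.
move=> c1 uc a l; have := lt_le_trans (uc a a) c1; rewrite !mxE eqxx subr0 mulr1n.
rewrite (bigD1 l) //= mul1r => h.
have s0 : 0 <= \sum_(i < k | i != l) 1 * (u a i * u a i).
  by apply: sumr_ge0 => i _; rewrite mul1r -expr2 sqr_ge0.
have : `|u a l| ^+ 2 < 2 ^+ 2.
  by rewrite real_normK ?num_real // expr2; move: h; rewrite ltr_norml; lra.
by rewrite ltr_pXn2r ?nnegrE.
Qed.

Lemma bounded_close (M e : R) u v : bounded_by M u -> close_mx e u v -> bounded_by (M + e) v.
Proof.
move=> uM uv a c; have := uM a c; have := uv a c.
by rewrite distrC => h1 h2; have := lerB_dist (v a c) (u a c); lra.
Qed.

(** Off [V_] some entry of [gram1] is nonzero and stays so nearby; compactness makes this uniform,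
    [bounded_of_gram] supplying the box. *)
Lemma near_V rh : 0 < rh -> exists2 c, 0 < c & forall v, close_mx c (gram1 v) 0 ->
  exists2 u, V_ R k u & close_mx rh u v.
Proof.
move=> rh0; have [|c c0 cP] := @uniform_on_box (fun d v => close_mx d (gram1 v) 0 ->
    exists2 u, V_ R k u & close_mx rh u v) 2.
  move=> u u2; have [Vu|/gram1_V nVu] := pselect (V_ R k u).
    by exists rh => // v d uv _ _; exists u.
  have [a [c uac]] : exists a c, gram1 u a c != 0.
    apply: contrapT => h; apply: nVu; apply/matrixP => a c; rewrite [RHS]mxE.
    by apply/eqP/negPn/negP => hh; apply: h; exists a, c.
  (* The box of radius [2] is enlarged to [3] because [v] may lie up to [1] away from [u]. *)
  have [C C0 CP] := gram1_lip 3.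
  pose g := `|gram1 u a c|; have g0 : 0 < g by rewrite normr_gt0.
  exists (Num.min 1 (Num.min (g / 2) (g / (2 * C)))).
    by rewrite !lt_min ltr01 !divr_gt0 // mulr_gt0.
  move=> v d uv /andP[d0]; rewrite !lt_min => /and3P[_ dg _] /(_ a c).
  rewrite [X in _ - X]mxE subr0 => h2.
  set e := Num.min _ _ in uv.
  have e0 : 0 < e by rewrite !lt_min ltr01 !divr_gt0 // mulr_gt0.
  have e1 : e <= 1 by rewrite ge_min lexx.
  have eC : C * e <= g / 2.
    rewrite (_ : g / 2 = C * (g / (2 * C))); last by field; rewrite gt_eqF.
    by rewrite ler_pM2l // !ge_min lexx !orbT.
  have u3 : bounded_by 3 u by move=> ? ?; apply: le_trans (u2 _ _) _; lra.
  have v3 : bounded_by 3 v.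
    by move=> i j; apply: le_trans (bounded_close u2 uv i j) _; lra.
  have := CP u v e e0 u3 v3 uv a c => h1.
  have := lerB_dist (gram1 u a c) (gram1 v a c); rewrite -/g => h3.
  lra.
exists (Num.min 1 (c / 2)); first by rewrite lt_min ltr01 divr_gt0.
move=> v vc; apply: (cP _ (Num.min 1 (c / 2))) => //.
  by move=> a l; rewrite ltW // (bounded_of_gram _ vc) // ge_min lexx.
rewrite lt_min ltr01 divr_gt0 //=.
by rewrite gt_min; apply/orP; right; rewrite ltr_pdivrMr // ltr_pMr // ltr1n.
Qed.

End Compactness.

(** * The quadratic reference map and its linearization *)

Section Quadratic.
Variables (R : realType) (k : nat).
Implicit Types (u v x : 'M[R]_k) (e d : R).

Lemma mx0E i j : (0 : 'M[R]_k) i j = 0. Proof. by rewrite mxE. Qed.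

Definition weight (l : 'I_k) : R := (l : nat)%:R.
(* Its zeros are the orthonormal bases diagonalizing a matrix with simple spectrum,
   that is, the signed permutation matrices. *)
Definition quad u : 'M[R]_k := mix (gram1 u) (qform weight u).

Lemma quad_actV u b : quad (actV R k u b) = actC (quad u) b.
Proof.
by rewrite /quad actC_mix ?gram1_sym ?qform_sym // gram1_actV qform_actV.
Qed.

Lemma quad_lip (M : R) : exists2 C, 0 < C & forall u v e, 0 < e ->
  bounded_by M u -> bounded_by M v -> close_mx e u v -> close_mx (C * e) (quad u) (quad v).
Proof.
have [C1 C10 P1] := gram1_lip k M; have [C2 C20 P2] := qform_lip weight M.
exists (C1 + C2); first exact: addr_gt0.
move=> u v e e0 uM vM uv a c; rewrite ![mix _ _ _ _]mxE.
have := P1 u v e e0 uM vM uv a c; have := P2 u v e e0 uM vM uv a c.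
case: ifP => _ h1 h2.
  by apply: lt_le_trans h2 _; rewrite ler_pM2r // lerDl ltW.
by apply: lt_le_trans h1 _; rewrite ler_pM2r // lerDr ltW.
Qed.

Definition mono_elt (s : 'S_k) (e : A_ k) : B_ k.
Proof. by apply: (@SdPair _ _ _ _ (sign_groupAction k) (s, e)); rewrite !inE. Defined.

(** The rows of [u] are eigenvectors of the diagonal matrix of weights. These are distinct, so each
    row has a single nonzero entry, equal to [1] or [-1]. *)
Lemma orthonormal_diag u : V_ R k u ->
  (forall i j, i != j -> qform weight u i j = 0) -> exists b, actV R k u b = 1%:M.
Proof.
move=> Vu u0.
have uuT : u *m u^T = 1%:M.
  by apply/matrixP => i j; rewrite !mxE -(Vu i j); apply: eq_bigr => l _; rewrite mxE.
have uTu : u^T *m u = 1%:M by apply: mulmx1C.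
have eig i l : u i l != 0 -> weight l = qform weight u i i.
  move=> uil; apply: (mulIf uil).
  have e : (qform weight u *m u) i l = (u *m diag_mx (\row_l weight l)) i l.
    by rewrite qformE -mulmxA uTu mulmx1.
  rewrite mul_mx_diag [LHS]mxE [RHS]mxE [(\row_l _) 0 l]mxE in e.
  rewrite (bigD1 i) //= big1 ?addr0 in e; first by rewrite mulrC -e.
  by move=> j ji; rewrite u0 1?eq_sym // mul0r.
have row_ex i : exists l, u i l != 0.
  apply: contrapT => /forallNP h; have := Vu i i; rewrite eqxx big1.
    by move/eqP; rewrite eq_sym oner_eq0.
  by move=> l _; have /negP/negPn/eqP-> := h l; rewrite mul0r.
pose t i := xchoose (row_ex i); have tP i : u i (t i) != 0 := xchooseP (row_ex i).
have uniq_t i l : u i l != 0 -> l = t i.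
  move=> uil; have := eig i l uil; rewrite -(eig i _ (tP i)) => /eqP.
  by rewrite eqr_nat => /eqP/ord_inj.
have zero i l : l != t i -> u i l = 0.
  by move=> lt; apply/eqP; apply: contraNT lt => /uniq_t->.
have rowE i j : \sum_l u i l * u j l = u i (t i) * u j (t i).
  by rewrite (bigD1 (t i)) //= big1 ?addr0 // => l /zero->; rewrite mul0r.
have tI : injective t.
  move=> i j tij; apply/eqP; apply: contraT => ij.
  have := Vu i j; rewrite rowE (negPf ij) => /eqP; rewrite mulf_eq0 (negPf (tP i)) /=.
  by rewrite tij (negPf (tP j)).
have sq i : u i (t i) * u i (t i) = 1 by rewrite -rowE Vu eqxx.
pose s := perm tI.
pose e : A_ k := [ffun i => if u (s^-1 i)%g i == 1 then 0%R else 1%R : 'Z_2].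
exists (mono_elt s e); apply/matrixP => i j; rewrite actVE mxE.
set i' := iperm _ i; have Ei : t i' = i by rewrite -[LHS](permE tI) -/s permKV.
have Ei' : i' = (s^-1)%g i by [].
have [<-|ij] := eqVneq i j; last by rewrite zero ?mulr0 // Ei eq_sym.
rewrite /eps /sg /sign_part /= ffunE -Ei'.
have := sq i'; rewrite Ei => /eqP; rewrite -expr2 sqrf_eq1.
case: eqVneq => [-> _|_ /= /eqP->]; first by rewrite expr0 mulr1.
by rewrite expr1 mulrNN mulr1.
Qed.

Lemma quad_eq0 u : quad u = 0 -> exists b, actV R k u b = 1%:M.
Proof.
have symE (A : 'M[R]_k) i j : A^T = A -> A i j = A j i.
  by move=> sA; rewrite -[in RHS]sA mxE.
move/matrixP => u0; apply: orthonormal_diag => [|i j ij].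
  apply/gram1_V/matrixP => i j; have := u0 i j; have := u0 j i.
  rewrite ![mix _ _ _ _]mxE !mx0E (symE _ j i (gram1_sym u)).
  by case: ltngtP.
have := u0 i j; have := u0 j i.
rewrite ![mix _ _ _ _]mxE !mx0E (symE _ j i (qform_sym weight u)).
by case: ltngtP => // /ord_inj e; rewrite e eqxx in ij.
Qed.

Lemma quad_far rh : 0 < rh -> exists2 ka, 0 < ka & forall v, bounded_by 2 v ->
  (forall b, ~ close_mx rh (actV R k v b) 1%:M) -> exists a c, ka <= `|quad v a c|.
Proof.
move=> rh0; have [|c c0 cP] := @uniform_on_box R k (fun d v =>
    (forall b, ~ close_mx rh (actV R k v b) 1%:M) -> exists a c, d <= `|quad v a c|) 2.
  move=> u u2; have [[b ub]|/forallNP far] :=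
      pselect (exists b, close_mx (rh / 2) (actV R k u b) 1%:M).
    exists (rh / 2); first by rewrite divr_gt0.
    move=> v d uv _ /(_ b); case; rewrite [rh]splitr; apply: close_trans ub.
    by apply: close_act; apply: close_sym.
  have [a [c uac]] : exists a c, quad u a c != 0.
    apply: contrapT => h; have [|b ub] := @quad_eq0 u.
      apply/matrixP => a c; rewrite [RHS]mxE; apply/eqP/negPn/negP => hh.
      by apply: h; exists a, c.
    apply: (far b); rewrite ub => a c; by rewrite subrr normr0 divr_gt0.
  have [C C0 CP] := quad_lip 3.
  pose g := `|quad u a c|; have g0 : 0 < g by rewrite normr_gt0.
  have e0 : 0 < Num.min 1 (Num.min (g / 2) (g / (2 * C))).
    by rewrite !lt_min ltr01 !divr_gt0 // mulr_gt0.
  exists (Num.min 1 (Num.min (g / 2) (g / (2 * C)))) => //.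
  move=> v d uv /andP[d0]; rewrite !lt_min => /and3P[_ dg _] _; exists a, c.
  set e := Num.min _ _ in uv e0.
  have e1 : e <= 1 by rewrite ge_min lexx.
  have eC : C * e <= g / 2.
    rewrite (_ : g / 2 = C * (g / (2 * C))); last by field; rewrite gt_eqF.
    by rewrite ler_pM2l // !ge_min lexx !orbT.
  have u3 : bounded_by 3 u by move=> ? ?; apply: le_trans (u2 _ _) _; lra.
  have v3 : bounded_by 3 v.
    by move=> i j; apply: le_trans (bounded_close u2 uv i j) _; lra.
  have := CP u v e e0 u3 v3 uv a c => h1.
  have := lerB_dist (quad u a c) (quad v a c); rewrite -/g => h3.
  lra.
exists (c / 2); first by rewrite divr_gt0.
move=> v v2 far; apply: cP => //; rewrite divr_gt0 //=.
by rewrite ltr_pdivrMr // ltr_pMr // ltr1n.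
Qed.

(* The derivative of [quad] at the identity. *)
Definition lin (x : 'M[R]_k) : 'M[R]_k :=
  \matrix_(i, j) if (i <= j)%N then x i j + x j i else weight j * x i j + weight i * x j i.

Lemma lin_is_linear : linear lin.
Proof.
move=> a x y; apply/matrixP => i j; rewrite !mxE.
by case: ifP => _; rewrite ?mxE; ring.
Qed.

HB.instance Definition _ := GRing.isLinear.Build R 'M[R]_k 'M[R]_k _ lin lin_is_linear.

Lemma weight_le l : 0 <= weight l <= k%:R.
Proof. by rewrite ler0n ler_nat ltnW. Qed.

(** The entries of [lin x] at [(j, i)] and [(i, j)] form a linear system in [x j i] and [x i j]
    whose determinant is, up to sign, [weight i - weight j], of absolute value at least [1].
    Simplicity of the spectrum thus makes the derivative invertible. *)
Lemma lin_lower x (M : R) : (forall a c, `|lin x a c| <= M) ->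
  forall a c, `|x a c| <= k.+1%:R * M.
Proof.
move=> h.
have M0 (a : 'I_k) : 0 <= M by apply: le_trans (normr_ge0 _) (h a a).
have key (i j : 'I_k) : (j < i)%N -> `|x j i| <= k%:R * M /\ `|x i j| <= k.+1%:R * M.
  move=> ji; have := h j i; have := h i j; rewrite !mxE leqNgt ji (ltnW ji) /=.
  have := M0 i; move: (x i j) (x j i) => p q M00 hpq hs.
  have q1 : `|q| <= k%:R * M.
    have e : (weight i - weight j) * q = (weight j * p + weight i * q) - weight j * (q + p) by ring.
    apply: (@le_trans _ _ (`|weight i - weight j| * `|q|)).
      rewrite ler_peMl // ger0_norm ?subr_ge0 ?ler_nat 1?ltnW //.
      by rewrite /weight -natrB ?(ltnW ji) // ler1n subn_gt0.
    rewrite -normrM e; apply: le_trans (ler_normB _ _) _.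
    apply: (@le_trans _ _ (M + weight j * M)).
      by rewrite lerD // normrM ger0_norm ?ler0n // ler_wpM2l ?ler0n.
    rewrite -[X in X + _]mul1r -mulrDl ler_wpM2r // /weight nat1r ler_nat.
    exact: ltn_ord j.
  split=> //; rewrite -natr1 mulrDl mul1r.
  have -> : p = - q + (q + p) by ring.
  by apply: le_trans (ler_normD _ _) _; rewrite normrN lerD.
move=> a c; case: (ltngtP a c) => [ac|ca|/ord_inj <-].
- apply: le_trans (key _ _ ac).1 _.
  by rewrite ler_wpM2r ?M0 // ler_nat.
- exact: (key _ _ ca).2.
- have := h a a; rewrite mxE leqnn ler_norml => /andP[h1 h2]; have M00 := M0 a; clear M0 key h.
  apply: (@le_trans _ _ M); first by rewrite ler_norml; apply/andP; split; lra.
  by rewrite ler_peMl // ler1n.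
Qed.

Lemma lin_eq0 x : lin x = 0 -> x = 0.
Proof.
move=> lx; apply/matrixP => a c; apply/eqP; rewrite mx0E -normr_le0.
rewrite -(mulr0 k.+1%:R); apply: lin_lower => i j.
by rewrite lx mxE normr0.
Qed.

Lemma lin_bound x d : (forall a c, `|x a c| <= d) ->
  forall a c, `|lin x a c| <= (k + k).+2%:R * d.
Proof.
move=> h a c; have d0 : 0 <= d by apply: le_trans (normr_ge0 _) (h a c).
rewrite mxE; have kk : (1 + 1) * d <= (k + k).+2%:R * d.
  by rewrite ler_wpM2r // -[1 + 1]/(2%:R) ler_nat.
have aM l i j : `|weight l * x i j| <= k%:R * d.
  have /andP[l0 lk] := weight_le l; rewrite normrM ger0_norm // ler_pM //.
case: ifP => _; apply: le_trans (ler_normD _ _) _.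
  by apply: le_trans kk; rewrite mulrDl mul1r lerD.
apply: (@le_trans _ _ (k%:R * d + k%:R * d)); first by rewrite lerD.
by rewrite -mulrDl ler_wpM2r // -natrD ler_nat; lia.
Qed.

(** No constant term remains: [gram1] vanishes at [1], and the diagonal matrix of weights is
    invisible below the diagonal. *)
Lemma quad_expand x : quad (1%:M + x) = lin x + mix (qform (fun=> 1) x) (qform weight x).
Proof.
have fE (be : 'I_k -> R) i j : qform be (1%:M + x) i j =
    be i * (j == i)%:R + (be j * x i j + be i * x j i) + qform be x i j.
  have pick (F : 'I_k -> R) (i0 : 'I_k) : \sum_l (i0 == l)%:R * F l = F i0.
    rewrite (bigD1 i0) //= eqxx mul1r big1 ?addr0 // => l li.
    by rewrite eq_sym (negPf li) mul0r.
  rewrite [LHS]mxE [qform be x i j]mxE.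
  rewrite -(pick (fun l => be l * (j == l)%:R) i).
  rewrite -(pick (fun l => be l * x i l) j) -(pick (fun l => be l * x j l) i) -!big_split /=.
  by apply: eq_bigr => l _; rewrite !mxE; ring.
apply/matrixP => i j; rewrite [LHS]mxE [RHS]mxE [lin x i j]mxE [mix _ _ _ _]mxE.
case: leqP => ij; last first.
  by rewrite fE -(inj_eq val_inj) /= ltn_eqF //= mulr0 add0r.
rewrite /gram1 mxE fE [(- 1%:M) i j]mxE [1%:M i j]mxE (eq_sym j); ring.
Qed.

Lemma qform_small be x d : (forall a c, `|x a c| <= d) ->
  forall a c, `|qform be x a c| <= (\sum_l `|be l|) * (d * d).
Proof.
move=> h a c; rewrite mxE mulr_suml; apply: le_trans (ler_norm_sum _ _ _) _.
apply: ler_sum => l _; rewrite normrM ler_wpM2l // normrM ler_pM //.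
Qed.

Lemma same_sign (s a : R) : `|a - s| < `|s| -> 0 < s * a.
Proof.
rewrite lter_distl; case: (ltrgt0P s) => [s0|s0|->].
- by rewrite subrr => /andP[a0 _]; rewrite mulr_gt0.
- by rewrite subrr => /andP[_ a0]; rewrite nmulr_lgt0.
by rewrite subr0 addr0 => /andP[h1 h2]; have := lt_trans h1 h2; rewrite ltxx.
Qed.

(** This serves the simplices on which the reference map changes from [lin] to [quad]: at distance
    of order [rh] from the identity one entry has the same sign for both, throughout a small
    neighbourhood and after the shift by [y]. *)
Lemma quad_lin_sign : exists2 r0, 0 < r0 & forall rh, 0 < rh < r0 ->
  exists2 d0, 0 < d0 & forall d, 0 < d < d0 -> forall v,
    (exists a c, rh / 2 <= `|v a c - (a == c)%:R|) -> close_mx (2 * rh) v 1%:M ->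
    exists a c s, forall v', close_mx d v v' ->
      0 < s * quad v' a c /\ forall y, close_mx d y 1%:M -> 0 < s * lin (v' - y) a c.
Proof.
pose S : R := 1 + \sum_(l < k) `|1 : R| + \sum_l `|weight l|.
have S1 : 0 < S by rewrite /S -addrA ltr_pwDl // addr_ge0 // sumr_ge0.
have [C C0 CP] := quad_lip 3.
exists (Num.min (1 / 2) (32 * S * k.+1%:R)^-1).
  by rewrite lt_min divr_gt0 // invr_gt0 !mulr_gt0.
move=> rh /andP[rh0]; rewrite lt_min => /andP[rh1 rhS].
(* If all entries of [lin x] were at most [M], then [lin_lower] would give [rh / 4] as a bound for
   [x]. The quadratic remainder, at most [4 S rh^2], and the variation of [quad] over distance [d]
   are each below [M / 2]. *)
pose M := rh / (4 * k.+1%:R); have M0 : 0 < M by rewrite divr_gt0 // mulr_gt0.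
have k0 : 0 < k.+1%:R :> R by rewrite ltr0n.
have kk0 : 0 < (k + k).+2%:R :> R by rewrite ltr0n.
exists (Num.min 1 (Num.min (M / (2 * C)) (M / (4 * (k + k).+2%:R)))).
  by rewrite !lt_min ltr01 !divr_gt0 // mulr_gt0.
move=> d /andP[d0]; rewrite !lt_min => /and3P[d1 dC dk] v [a0 [c0 vac]] v1.
pose x := v - 1%:M; have vE : v = 1%:M + x by rewrite addrC subrK.
have xE a c : x a c = v a c - (a == c)%:R by rewrite !mxE.
have x2 a c : `|x a c| <= 2 * rh by rewrite xE ltW //; have := v1 a c; rewrite mxE.
have [a [c Lac]] : exists a c, M < `|lin x a c|.
  apply: contrapT => h; have {}h i j : `|lin x i j| <= M.
    by rewrite leNgt; apply/negP => hh; apply: h; exists i, j.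
  have := lin_lower h a0 c0; rewrite xE.
  have -> : k.+1%:R * M = rh / 4 by rewrite /M; field; rewrite gt_eqF.
  lra.
exists a, c, (lin x a c) => v' vv'.
have dC' : C * d < M / 2.
  rewrite (_ : M / 2 = C * (M / (2 * C))); last by field; rewrite gt_eqF.
  by rewrite ltr_pM2l.
have dk' : (k + k).+2%:R * d < M / 4.
  rewrite (_ : M / 4 = (k + k).+2%:R * (M / (4 * (k + k).+2%:R))); last first.
    by field; rewrite gt_eqF.
  by rewrite ltr_pM2l.
split.
  apply: same_sign; apply: lt_trans Lac.
  have v2 : bounded_by 2 v.
    move=> i j; have := x2 i j; rewrite xE => h.
    have := ler_distD 0 (v i j) (i == j)%:R; rewrite !subr0 sub0r normrN => _.
    have := lerB_dist (v i j) ((i == j)%:R); rewrite [`|_%:R|]ger0_norm ?ler0n // => h2.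
    have : (i == j)%:R <= 1 :> R by case: (i == j).
    by lra.
  have v3 : bounded_by 3 v by move=> ? ?; apply: le_trans (v2 _ _) _; lra.
  have v'3 : bounded_by 3 v'.
    by move=> i j; apply: le_trans (bounded_close v2 vv' i j) _; lra.
  have h1 := CP v v' d d0 v3 v'3 vv' a c.
  have : `|quad v a c - lin x a c| <= S * ((2 * rh) * (2 * rh)).
    rewrite vE quad_expand [X in X - _]mxE addrAC subrr add0r [mix _ _ _ _]mxE.
    have rr : 0 <= (2 * rh) * (2 * rh) by rewrite -expr2 sqr_ge0.
    case: ifP => _; apply: le_trans (qform_small _ x2 _ _) _; rewrite ler_wpM2r // /S.
      by rewrite addrAC lerDr addr_ge0 // sumr_ge0.
    by rewrite lerDr addr_ge0 // sumr_ge0.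
  have : S * ((2 * rh) * (2 * rh)) < M / 2.
    rewrite -(ltr_pM2r (_ : 0 < 32 * S * k.+1%:R)) ?mulr_gt0 // in rhS.
    rewrite mulVf ?gt_eqF ?mulr_gt0 // in rhS.
    rewrite (_ : M / 2 = (rh / (8 * k.+1%:R)) * 1); last by rewrite /M; field; rewrite gt_eqF.
    rewrite (_ : S * _ = (rh / (8 * k.+1%:R)) * (rh * (32 * S * k.+1%:R))); last first.
      by field; rewrite gt_eqF.
    by rewrite ltr_pM2l // divr_gt0 // mulr_gt0.
  have := ler_distD (quad v a c) (quad v' a c) (lin x a c); rewrite distrC in h1.
  by lra.
move=> y y1; apply: same_sign; apply: lt_trans Lac.
have -> : lin (v' - y) a c - lin x a c = lin ((v' - v) - (y - 1%:M)) a c.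
  have -> : v' - v - (y - 1%:M) = (v' - y) - x.
    by rewrite /x !opprB; apply/matrixP => i j; rewrite !mxE; ring.
  by rewrite [in RHS]linearB /= [RHS]mxE [(- lin x) a c]mxE.
have dd i j : `|((v' - v) - (y - 1%:M)) i j| <= 2 * d.
  have := vv' i j; have := y1 i j; rewrite distrC => h1 h2.
  rewrite !mxE in h1 *; apply: le_trans (ler_normB _ _) _.
  rewrite [`|v' i j - _|]distrC [`|y i j - _|]distrC.
  by rewrite mulrDl mul1r lerD // ltW.
by apply: le_lt_trans (lin_bound dd _ _) _; lra.
Qed.

End Quadratic.

(** * Uniform sign control for a map without zeros *)

Section Sign.
Variables (R : realType) (k : nat).

(** Continuity of [f] enters the proof here only. The coordinate is taken below the diagonal, where
    [mix] stores the part coming from [f]. *)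
Lemma target_sign (f : 'M[R]_k -> W2p R k) :
  {within V_ R k, continuous f} -> (forall u, V_ R k u -> f u != 0) ->
  exists2 e : R, 0 < e & forall u, V_ R k u -> exists i j : 'I_k, exists s : R, (j < i)%N /\
    forall u', V_ R k u' -> close_mx e u u' -> 0 < s * coordM (f u') i j.
Proof.
move=> /subspace_continuousP fc f0.
have [|e e0 eP] := @uniform_on_box R k (fun d v => V_ R k v ->
    exists i j : 'I_k, exists s : R, (j < i)%N /\
    forall u', V_ R k u' -> close_mx d v u' -> 0 < s * coordM (f u') i j) 2.
  (* At a point off [V_] the claim holds vacuously in a ball that misses [V_]. *)
  move=> u u2; have [Vu|nVu] := pselect (V_ R k u); last first.
    have [a [c uac]] : exists a c, gram1 u a c != 0.
      apply: contrapT => h; apply: nVu; apply/gram1_V/matrixP => a c; rewrite [RHS]mxE.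
      by apply/eqP/negPn/negP => hh; apply: h; exists a, c.
    have [C C0 CP] := gram1_lip k (3 : R).
    pose g := `|gram1 u a c|; have g0 : 0 < g by rewrite normr_gt0.
    have e0 : 0 < Num.min 1 (g / C) by rewrite lt_min ltr01 divr_gt0.
    exists (Num.min 1 (g / C)) => // v d uv _ Vv; exfalso.
    have u3 : bounded_by 3 u by move=> ? ?; apply: le_trans (u2 _ _) _; lra.
    have v3 : bounded_by 3 v.
      move=> i j; apply: le_trans (bounded_close u2 uv i j) _.
      have : Num.min 1 (g / C) <= 1 by rewrite ge_min lexx.
      by lra.
    have := CP u v _ e0 u3 v3 uv a c; rewrite (gram1_V v).1 // [X in _ - X]mxE subr0 -/g.
    apply/negP; rewrite -leNgt -ler_pdivlMl // mulrC ge_min lexx orbT.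
    by [].
  have [i [j [ji fij]]] := coordM_neq0 (f0 u Vu).
  move: fij; rewrite mxE; case E: (insub _) => [p|]; last by rewrite eqxx.
  rewrite /coordW => fp.
  have := fc u Vu; move=> /cvgrPdist_lt/(_ `|f u 0 (enum_rank p)|).
  rewrite normr_gt0 fp => /(_ isT).
  move=> H; have /nbhs_ballP[e /= e0 eP] : nbhs u [set y | V_ R k y ->
    `|f u - f y| < `|f u 0 (enum_rank p)|] by exact: H.
  exists (e / 2); first by rewrite divr_gt0.
  move=> v d uv /andP[d0 de] Vv; exists i, j, (f u 0 (enum_rank p)); split=> // u' Vu' vu'.
  rewrite mxE E /coordW; apply: same_sign; rewrite distrC.
  have : `|f u - f u'| < `|f u 0 (enum_rank p)|.
    apply: (eP u' _ Vu'); split=> // a c; rewrite [e]splitr.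
    exact: (close_trans uv (close_mxW (ltW de) vu')).
  apply: le_lt_trans.
  have -> : f u 0 (enum_rank p) - f u' 0 (enum_rank p) = (f u - f u') 0 (enum_rank p).
    by rewrite !mxE.
  have /mapP[h Hh ->] : `|(f u - f u') 0 (enum_rank p)| \in
      [seq `|(f u - f u') x.1 x.2| | x : 'I_1 * 'I__].
    by apply/mapP; exists (ord0, enum_rank p) => //=; rewrite mem_enum.
  by rewrite [leRHS]/Num.norm /= mx_normrE; apply/bigmax_geP; right => /=; exists h.
exists (e / 2); first by rewrite divr_gt0.
move=> u Vu; apply: eP => //; last by rewrite divr_gt0 //= ltr_pdivrMr // ltr_pMr // ltr1n.
have V0 := (gram1_V u).1 Vu => a c; rewrite ltW // (@bounded_of_gram _ _ u 1) // V0 => i j.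
by rewrite subrr normr0.
Qed.

End Sign.

(** * Perturbations *)

Section Perturbation.
Variable R : realType.

Lemma near_imp (P : Prop) (Q : R -> Prop) (F : set_system R) (FF : Filter F) :
  (P -> \forall t \near F, Q t) -> \forall t \near F, P -> Q t.
Proof.
move=> h; have [/h|nP] := pselect P; first by apply: filterS => t ? _.
by apply: filterS filterT => t _ /nP.
Qed.

(** An open certificate that the origin is not in the convex hull, hence one that survives small
    perturbations. *)
Definition positive_on (m n : nat) (v : 'I_m -> 'rV[R]_n) : Prop :=
  exists chi : 'cV[R]_n, forall i, 0 < (v i *m chi) 0 0.

Lemma near_gt0 (a b : R) : 0 < a -> \forall t \near 0^'+, 0 < a + t * b.
Proof.
move=> a0; have b1 : 0 < `|b| + 1 by rewrite ltr_wpDl.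
have e0 : 0 < a / (`|b| + 1) by rewrite divr_gt0.
apply: filterS2 (nbhs_right_gt 0) (nbhs_right_lt e0) => t t0.
rewrite (ltr_pdivlMr _ _ b1) mulrDr mulr1 => h.
have : - (t * `|b|) <= t * b by rewrite -mulrN ler_pM2l // lerNl -normrN ler_norm.
by lra.
Qed.

Lemma near_not_zero_in (m n : nat) (v w : 'I_m.+1 -> 'rV[R]_n) :
  positive_on v -> \forall t \near 0^'+, ~ zero_in (fun i => v i + t *: w i).
Proof.
move=> [chi chi0].
have : \forall t \near 0^'+, forall i, 0 < (v i *m chi) 0 0 + t * (w i *m chi) 0 0.
  by apply: filter_forall => i; exact: near_gt0.
apply: filterS => t t0 [c c0 cv].
have : ((\sum_i c i *: (v i + t *: w i)) *m chi) 0 0 = 0 by rewrite cv mul0mx mxE.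
rewrite mulmx_suml summxE => s0.
suff : 0 < \sum_i ((c i *: (v i + t *: w i)) *m chi) 0 0 by rewrite s0 ltxx.
rewrite big_ord_recl ltr_pwDl //; last apply: sumr_ge0 => i _.
  by rewrite -scalemxAl mxE mulmxDl -scalemxAl mxE [X in _ + X]mxE mulr_gt0.
by rewrite -scalemxAl mxE mulmxDl -scalemxAl mxE [X in _ + X]mxE ltW // mulr_gt0.
Qed.

Lemma near_generic (n : nat) (v w : 'I_n.+2 -> 'rV[R]_n) : generic w ->
  \forall t \near 0^'+, generic (fun a => v a + t *: w a).
Proof.
move=> gw; have : \forall t \near 0^'+, forall h : {ffun 'I_n -> 'I_n.+2},
    injective h -> \det (\matrix_l (v (h l) + t *: w (h l))) != 0.
  apply: filter_forall => h; apply: near_imp => hI.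
  apply: filterS (near_det_neq0 (\matrix_l v (h l)) (gw h hI)) => t.
  congr (\det _ != 0); apply/row_matrixP => l.
  by rewrite raddfD /= linearZ /= !rowK.
apply: filterS => t H h hI; pose h' : {ffun 'I_n -> 'I_n.+2} := [ffun l => h l].
have h'E l : h' l = h l by rewrite ffunE.
have := H h'; under eq_mx do rewrite h'E.
by apply => l l'; rewrite !h'E; exact: hI.
Qed.

Lemma positive_on_mul (m n : nat) (v : 'I_m -> 'rV[R]_n) (A : 'M[R]_n) :
  A \in unitmx -> positive_on v -> positive_on (fun i => v i *m A).
Proof.
by move=> uA [chi h]; exists (invmx A *m chi) => i; rewrite mulmxA mulmxK.
Qed.

Lemma positive_on_entry (m k : nat) (X : 'I_m -> 'M[R]_k) a c s :
  (forall i, 0 < s * X i a c) -> positive_on (fun i => mxvec (X i)).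
Proof.
move=> h; exists (s *: delta_mx (mxvec_index a c) 0) => i.
by rewrite -scalemxAr mxE -colE mxE mxvecE.
Qed.

Lemma zero_in_mul (m n : nat) (v : 'I_m -> 'rV[R]_n) (A : 'M[R]_n) :
  A \in unitmx -> zero_in (fun i => v i *m A) <-> zero_in v.
Proof.
move=> uA; have E (c : 'I_m -> R) : \sum_i c i *: (v i *m A) = (\sum_i c i *: v i) *m A.
  by rewrite mulmx_suml; apply: eq_bigr => i _; rewrite scalemxAl.
split=> -[c c0 h]; exists c => //; last by rewrite E h mul0mx.
by rewrite -(mulmxK uA (\sum_i c i *: v i)) -E h mul0mx.
Qed.

Lemma near_horner_gt0 (p : {poly R}) : 0 < p.[0] -> \forall t \near 0^'+, 0 < p.[t].
Proof.
move=> p0; have := @continuous_horner R p 0.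
move=> /cvgrPdist_lt/(_ _ p0) => H; have : \forall t \near 0^'+, `|p.[0] - p.[t]| < p.[0].
  exact: cvg_within H.
by apply: filterS => t; rewrite ltr_norml; lra.
Qed.

(* The barycenter of a nondegenerate simplex remains interior under small
   perturbations of the vertices. *)
Lemma near_zero_in (n : nat) (w y : 'I_n.+1 -> 'rV[R]_n) :
  \sum_i w i = 0 -> \det (\matrix_i w (lift ord0 i)) != 0 ->
  \forall t \near 0^'+, zero_in (fun i => w i + t *: y i).
Proof.
move=> w0 dW; set W := \matrix_i _ in dW; pose Y := \matrix_i y (lift ord0 i).
pose z := \sum_i y i.
pose Cp : 'M[{poly R}]_n := map_mx polyC W + 'X *: map_mx polyC Y.
have CpE t : map_mx (horner_eval t) Cp = W + t *: Y.
  by apply/matrixP => i j; rewrite !mxE /horner_eval hornerD hornerM !hornerC hornerX.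
pose D := \det Cp; pose a := map_mx polyC z *m \adj Cp.
have DE t : D.[t] = \det (W + t *: Y) by rewrite -CpE det_map_mx.
have aE t i : (a 0 i).[t] = (z *m \adj (W + t *: Y)) 0 i.
  rewrite -CpE -map_mx_adj -[LHS]/(horner_eval t (a 0 i)).
  have -> : z = map_mx (horner_eval t) (map_mx polyC z).
    by apply/matrixP => ? ?; rewrite !mxE /horner_eval hornerC.
  by rewrite -map_mxM [RHS]mxE.
have nD : \forall t \near 0^'+, D.[t] != 0.
  apply: near_horner_neq0; apply: contra dW => /eqP D0.
  by have := DE 0; rewrite D0 horner0 scale0r addr0 => <-.
(* Expresses [|t a_i / D| < 1] as positivity of a polynomial at [t]; at [t = 0] it reads
   [0 < D^2]. *)
have nP : \forall t \near 0^'+, forall i, 0 < (D ^+ 2 - ('X * a 0 i) ^+ 2).[t].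
  apply: filter_forall => i; apply: near_horner_gt0.
  rewrite hornerD hornerN !horner_exp hornerM hornerX mul0r expr0n subr0.
  by rewrite DE scale0r addr0 lt_neqAle sqr_ge0 eq_sym sqrf_eq0 dW.
apply: filterS2 nD nP => t Dt Pt.
pose mu := (- (t / D.[t])) *: (z *m \adj (W + t *: Y)).
have muC : mu *m (W + t *: Y) = - (t *: z).
  rewrite -scalemxAl -mulmxA mul_adj_mx -DE mul_mx_scalar scalerA.
  by rewrite mulNr divfK // scaleNr.
have mu1 i : 0 < 1 + mu 0 i.
  have := Pt i; rewrite hornerD hornerN !horner_exp hornerM hornerX aE subr_gt0.
  rewrite -[X in X < _]real_normK ?num_real // -[X in _ < X]real_normK ?num_real //.
  rewrite ltr_pXn2r ?nnegrE // => h.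
  have : `|mu 0 i| < 1.
    rewrite mxE normrM normrN normrM normfV mulrAC -normrM ltr_pdivrMr ?normr_gt0 //.
    by rewrite mul1r.
  by rewrite ltr_norml; lra.
(* Equal weights leave the error [t z]; the correction [mu], found by Cramer's rule, cancels it
   using all vertices but the first. *)
exists (fun i => if unlift ord0 i is Some j then 1 + mu 0 j else 1).
  by move=> i; case: unlift.
rewrite big_ord_recl unlift_none scale1r.
under eq_bigr do rewrite liftK scalerDl scale1r.
rewrite big_split /= addrA -(big_ord_recl n (fun i => w i + t *: y i)).
rewrite big_split /= w0 add0r -scaler_sumr -/z -[RHS](subrr (t *: z)) -muC.
congr (_ + _); rewrite mulmx_sum_row; apply: eq_bigr => i _.
by congr (_ *: _); apply/rowP => j; rewrite !mxE.
Qed.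

Section Std.
Variables (k m q : nat).
Hypotheses (q_gt0 : (0 < q)%N) (q_le_m : (q <= m)%N) (k_gt0 : (0 < k)%N).
Local Notation n := (k * k)%N.
Let u (j : nat) : 'rV[R]_n := mxvec (vert R q (std k m q) j - barycenter R k m q).

Lemma sum_std : \sum_(j < n.+1) u j = 0.
Proof.
rewrite /u -linear_sum /= sumrB sumr_const card_ord /barycenter.
by rewrite -scaler_nat scalerA mulfV ?pnatr_eq0 // scale1r subrr linear0.
Qed.

(** A dependency [v] with total [T] has tail sums [S p = theta p * T]. Since [S 0 = T] and
    [theta 0 < 1], [T] vanishes, so all tail sums do, and with them their differences [v i]. *)
Lemma det_std : \det (\matrix_(i < n) u (lift ord0 i)) != 0.
Proof.
have q2 : (2 * q)%:R != 0 :> R by rewrite pnatr_eq0 muln_eq0 /= -lt0n.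
apply/negP => /det0P[v v0 vM]; case/eqP: v0.
pose T := \sum_i v 0 i; pose S (p : nat) := \sum_(i < n) v 0 i * (p <= i)%N%:R.
have ST (p : 'I_n) : S p = theta R k p * T.
  case/mxvec_indexP: p => a c; move/rowP/(_ (mxvec_index a c)): vM.
  rewrite !mxE.
  under eq_bigr => i _ do rewrite !mxE.
  under eq_bigr => i _ do rewrite mxvecE mxE vert_std // [(- barycenter _ _ _ _) a c]mxE
    barycenterE // opprD addrACA subrr add0r -mulrBl mulrA.
  rewrite -mulr_suml => /eqP; rewrite mulf_eq0 invr_eq0 (negPf q2) orbF.
  under eq_bigr do rewrite mulrBr /= /bump add1n ltnS.
  by rewrite sumrB -mulr_suml subr_eq0 mulrC => /eqP.
have n0 : (0 < n)%N by rewrite muln_gt0 k_gt0.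
have T0 : T = 0.
  have := ST (Ordinal n0); rewrite /S; under eq_bigr do rewrite leq0n mulr1.
  rewrite -/T => /eqP; rewrite -subr_eq0 -[X in X - _]mul1r -mulrBl mulf_eq0.
  move=> /orP[|/eqP//].
  by rewrite subr_eq0 gt_eqF // theta_lt1.
have S0 p : S p = 0.
  case: (ltnP p n) => pn; first by rewrite (ST (Ordinal pn)) T0 mulr0.
  by rewrite /S big1 // => i _; rewrite leqNgt (leq_trans (ltn_ord i) pn) mulr0.
apply/rowP => i; rewrite mxE.
have : S i - S i.+1 = v 0 i.
  rewrite /S -sumrB (bigD1 i) //= leqnn ltnn mulr1 mulr0 subr0 big1 ?addr0 // => j ji.
  by rewrite -mulrBr ltn_neqAle -(inj_eq val_inj) /= eq_sym in ji *; rewrite ji subrr mulr0.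
by rewrite !S0 subrr.
Qed.

End Std.

Section Lin.
Variable k : nat.

Definition lin_mat : 'M[R]_(k * k) :=
  lin1_mx (fun x : 'rV[R]_(k * k) => mxvec (lin (vec_mx x))).

Lemma mul_lin_mat (x : 'M[R]_k) : mxvec x *m lin_mat = mxvec (lin x).
Proof.
rewrite (mul_rV_lin1 [the {linear 'rV[R]_(k * k) -> 'rV[R]_(k * k)} of
  mxvec \o @lin R k \o vec_mx]).
by rewrite /= mxvecK.
Qed.

Lemma lin_mat_unit : lin_mat \in unitmx.
Proof.
rewrite unitmxE unitfE; apply/negP => /det0P[v v0 vM]; case/eqP: v0.
rewrite -[v]vec_mxK in vM *; rewrite mul_lin_mat in vM.
have /lin_eq0-> : lin (vec_mx v) = 0 by rewrite -[LHS]mxvecK vM linear0.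
by rewrite linear0.
Qed.

End Lin.
End Perturbation.

(** * Comparison with a reference map *)

Section Model.
Variables (R : realType) (k : nat) (f : 'M[R]_k -> W2p R k).
Hypothesis k_gt0 : (0 < k)%N.
Hypothesis f_equiv : forall u b, V_ R k u -> f (actV R k u b) = actW R k (f u) b.
Variables (c rv rh ka : R) (q : nat).
Hypotheses (c_gt0 : 0 < c) (c_half : c <= 1 / 2).
Hypothesis near_orthonormal : forall v : 'M[R]_k, close_mx c (gram1 v) 0 ->
  exists2 u, V_ R k u & close_mx rv u v.
Hypothesis f_sign : forall u, V_ R k u ->
  exists i j : 'I_k, exists s : R, (j < i)%N /\
    forall u', V_ R k u' -> close_mx (3 * rv) u u' -> 0 < s * coordM (f u') i j.
Hypotheses (rh_gt0 : 0 < rh) (rh_small : rh <= 1 / 8).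
Hypothesis gram_ball : forall v : 'M[R]_k,
  close_mx (2 * rh) v 1%:M -> close_mx (c / 2) (gram1 v) 0.
Hypotheses (q_gt0 : (0 < q)%N) (q_rv : q%:R^-1 <= rv) (q_rh : q%:R^-1 <= rh).
Hypothesis gram_mesh : forall u v : 'M[R]_k, bounded_by 3 u -> bounded_by 3 v ->
  close_mx q%:R^-1 u v -> close_mx (c / 2) (gram1 u) (gram1 v).
Hypothesis quad_away : forall v : 'M[R]_k, bounded_by 2 v ->
  (forall b, ~ close_mx rh (actV R k v b) 1%:M) -> exists a l, ka <= `|quad v a l|.
Hypothesis quad_mesh : forall u v : 'M[R]_k, bounded_by 3 u -> bounded_by 3 v ->
  close_mx q%:R^-1 u v -> close_mx ka (quad u) (quad v).
Hypothesis quad_lin_mesh : forall v : 'M[R]_k,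
  (exists a l, rh / 2 <= `|v a l - (a == l)%:R|) -> close_mx (2 * rh) v 1%:M ->
  exists a l s, forall v', close_mx q%:R^-1 v v' ->
    0 < s * quad v' a l /\
    forall y, close_mx q%:R^-1 y 1%:M -> 0 < s * lin (v' - y) a l.

Local Notation n := (k * k)%N.
Local Notation m := (2 * q)%N.
Local Notation act := (actV R k).
Implicit Types (u v : 'M[R]_k) (b : B_ k) (x : simplex k m).

Definition tame u := close_mx c (gram1 u) 0.
Definition near1 u := close_mx rh u 1%:M.

Lemma actV_one u : act u 1%g = u. Proof. exact: actV1. Qed.
Lemma actV_mul u b b' : act u (b * b')%g = act (act u b) b'. Proof. exact: actVM. Qed.
Lemma actVK u b : act (act u b) b^-1%g = u.
Proof. by rewrite -actV_mul mulgV actV_one. Qed.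
Lemma tame_act u b : tame u -> tame (act u b).
Proof.
move=> h a l; have := h (iperm b a) (iperm b l); rewrite !mx0E !subr0.
by rewrite gram1_actV [conjB _ _ _ _]mxE !normrM !norm_eps !mul1r.
Qed.

Lemma tame_lt2 u a l : tame u -> `|u a l| < 2.
Proof. by move=> /bounded_of_gram; apply; rewrite (le_trans c_half) //; lra. Qed.

(** Rows have squared norm above [1/2] and mutual inner products below [1/2] in absolute value. A
    moved row would be another row up to sign, and a fixed row with sign [-1] would be zero. *)
Lemma tame_free u b : tame u -> act u b = u -> b = 1%g.
Proof.
move=> tu ub; have e a l : u a l = eps R b a * u (iperm b a) l by rewrite -actVE ub.
have gE a l : (gram1 u) a l = \sum_i u a i * u l i - (a == l)%:R.
  by rewrite !mxE; congr (_ - _); apply: eq_bigr => i _; rewrite mul1r.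
have sq a : 1 / 2 < \sum_i u a i * u a i.
  have := tu a a; rewrite gE mx0E subr0 eqxx mulr1n => /lt_le_trans/(_ c_half).
  by rewrite ltr_norml; lra.
have fixed a : iperm b a = a.
  apply/eqP; apply: contraT => ba.
  have := tu a (iperm b a); rewrite gE mx0E subr0 eq_sym (negPf ba) subr0.
  under eq_bigr => i _ do rewrite {1}e -mulrA.
  rewrite -mulr_sumr normrM norm_eps mul1r => /lt_le_trans/(_ c_half).
  by have := sq (iperm b a); rewrite ltr_norml; lra.
apply: (@B_eq1 R) => [//|a]; have := eps_cases R b a => /orP[/eqP//|/eqP ea].
have u0 i : u a i = 0 by have := e a i; rewrite fixed ea; lra.
by have := sq a; rewrite big1 => [|i _]; rewrite ?u0 ?mul0r //; lra.
Qed.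

Lemma close1_free u b : close_mx (1 / 2) u 1%:M -> close_mx (1 / 2) (act u b) 1%:M -> b = 1%g.
Proof.
move=> hu hub.
have fixed a : iperm b a = a.
  apply/eqP; apply: contraT => ba.
  have := hu (iperm b a) a; have := hub a a; rewrite actVE !mxE eqxx (negPf ba) mulr1n subr0.
  by case/orP: (eps_cases R b a) => /eqP->; rewrite !ltr_norml; lra.
apply: (@B_eq1 R) => [//|a]; have := eps_cases R b a => /orP[/eqP//|/eqP ea].
have := hu a a; have := hub a a; rewrite actVE fixed ea !mxE eqxx mulr1n.
by rewrite !ltr_norml; lra.
Qed.

Lemma near1_free u b : near1 u -> near1 (act u b) -> b = 1%g.
Proof.
by move=> h1 h2; apply: (@close1_free u);
  [apply: close_mxW h1|apply: close_mxW h2]; move: rh_small; lra.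
Qed.

Lemma near1_tame u : near1 u -> tame u.
Proof.
move=> h; apply: (@close_mxW _ _ (c / 2)); first by move: c_gt0; lra.
by apply: gram_ball; apply: close_mxW h; move: rh_gt0; lra.
Qed.

Definition in_orbit u : pred 'M[R]_k := [pred w | [exists b, act u b == w]].
(* Close to the orbit of the identity matrix the representative is the point near
   to the identity itself, so that the linearization there can be used. *)
Definition orbit_rep u := if [pick b | `[< near1 (act u b) >]] is Some b then act u b
  else choose (in_orbit u) u.

Lemma in_orbit_act u b : in_orbit (act u b) =1 in_orbit u.
Proof.
move=> w; apply/existsP/existsP => -[b' /eqP <-].
  by exists (b * b')%g; rewrite actV_mul.
by exists (b^-1 * b')%g; rewrite actV_mul actVK.
Qed.

Lemma rep_act u b : orbit_rep (act u b) = orbit_rep u.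
Proof.
rewrite /orbit_rep; case: pickP => [b1 /asboolP h1|h1]; case: pickP => [b2 /asboolP h2|h2].
- have : near1 (act (act u b2) (b2^-1 * b * b1)%g).
    by rewrite -actV_mul !mulgA mulgV mul1g actV_mul.
  move=> /(near1_free h2) e.
  by rewrite -actV_mul; congr (act u _); rewrite -[RHS]mulg1 -e !mulgA mulgV mul1g.
- by have := h2 (b * b1)%g; rewrite actV_mul => /negP[]; apply/asboolP.
- by have := h1 (b^-1 * b2)%g; rewrite actV_mul actVK => /negP[]; apply/asboolP.
rewrite (eq_choose (in_orbit_act u b)); apply: choose_id.
  by apply/existsP; exists b.
by apply/existsP; exists 1%g; rewrite actV_one.
Qed.

Lemma rep_ex u : exists b, act (orbit_rep u) b == u.
Proof.
rewrite /orbit_rep; case: pickP => [b _|_]; first by exists b^-1%g; rewrite actVK.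
have : in_orbit u (choose (in_orbit u) u).
  by apply: chooseP; apply/existsP; exists 1%g; rewrite actV_one.
by case/existsP => b /eqP <-; exists b^-1%g; rewrite actVK.
Qed.

Definition orbit_elt u := xchoose (rep_ex u).

Lemma grpP u : act (orbit_rep u) (orbit_elt u) = u.
Proof. exact/eqP/(xchooseP (rep_ex u)). Qed.

Lemma rep_tame u : tame u -> tame (orbit_rep u).
Proof. by move=> tu; rewrite -(actVK (orbit_rep u) (orbit_elt u)) grpP; apply: tame_act. Qed.

Lemma grp_act u b : tame u -> orbit_elt (act u b) = (orbit_elt u * b)%g.
Proof.
move=> tu; have := grpP (act u b); rewrite rep_act -{3}(grpP u) -actV_mul => e.
have : act (orbit_rep u) (orbit_elt (act u b) * (orbit_elt u * b)^-1)%g = orbit_rep u.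
  by rewrite actV_mul e actVK.
move=> /(tame_free (rep_tame tu)) h.
by rewrite -[LHS](mulgKV (orbit_elt u * b)%g) h mul1g.
Qed.

Lemma rep_near1 u : near1 u -> orbit_rep u = u.
Proof.
move=> nu; rewrite /orbit_rep; case: pickP => [b /asboolP/(near1_free nu) ->|/(_ 1%g)].
  by rewrite actV_one.
by rewrite actV_one => /negP[]; apply/asboolP.
Qed.

Lemma grp_near1 u : near1 u -> orbit_elt u = 1%g.
Proof.
move=> nu; apply: (tame_free (near1_tame nu)).
by rewrite -{1}(rep_near1 nu) grpP.
Qed.

(** [f] is controlled on [V_] only, so it is evaluated at an orthonormal basis near [w]; one exists
    for tame [w]. *)
Definition nearby_orthonormal w := xget w [set v | V_ R k v /\ close_mx rv v w].
(* Level [true] is the given map, level [false] the reference map: [quad],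
   linearized near the identity and shifted so that its zero there is the
   barycenter of a simplex. Continuity of the values is not needed. *)
Definition base_value (lev : bool) (w : 'M[R]_k) : 'M[R]_k :=
  if lev then mix (gram1 w) (coordM (f (nearby_orthonormal w)))
  else if `[< near1 w >] then lin (w - barycenter R k m q) else quad w.
Definition equivariant_value lev u := actC (base_value lev (orbit_rep u)) (orbit_elt u).

Lemma eqv_act lev u b : tame u -> equivariant_value lev (act u b) = actC (equivariant_value lev u) b.
Proof. by move=> tu; rewrite /equivariant_value rep_act grp_act // actCM. Qed.

Lemma eqv_true u : tame u -> exists v, [/\ V_ R k v, close_mx rv v u &
  equivariant_value true u = mix (gram1 u) (coordM (f v))].
Proof.
move=> tu; have [v0 Vv0 cv0] := near_orthonormal (rep_tame tu).
have [Vp cp] : V_ R k (nearby_orthonormal (orbit_rep u)) /\ close_mx rv (nearby_orthonormal (orbit_rep u)) (orbit_rep u).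
  by apply: (@xgetPex _ (orbit_rep u) [set v | V_ R k v /\ close_mx rv v (orbit_rep u)]); exists v0.
exists (act (nearby_orthonormal (orbit_rep u)) (orbit_elt u)); split.
- exact: actV_stable.
- by rewrite -[X in close_mx _ _ X](grpP u); apply: close_act.
rewrite /equivariant_value /base_value actC_mix ?gram1_sym ?coordM_sym // -gram1_actV grpP.
by rewrite f_equiv // coordM_actW.
Qed.

Lemma eqv_near u : near1 u -> equivariant_value false u = lin (u - barycenter R k m q).
Proof.
move=> nu; rewrite /equivariant_value /base_value rep_near1 // grp_near1 // actC1.
by rewrite asboolT.
Qed.

Lemma eqv_far u : (forall b, ~ near1 (act u b)) -> equivariant_value false u = quad u.
Proof.
move=> nu; rewrite /equivariant_value /base_value asboolF -?quad_actV ?grpP // => h.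
by apply: (nu (orbit_elt u)^-1%g); rewrite -{1}(grpP u) actVK.
Qed.

(** * Perturbed vertex values and the count of zeros *)

Section WithFamily.
Variable y : bool * 'I_n.+1 -> 'rV[R]_n.
Hypothesis y_generic : forall (h : 'I_n -> bool * 'I_n.+1) (g : 'I_n -> B_ k),
  injective h -> \det (\matrix_i (y (h i) *m rho R (g i))) != 0.

(** The finitely many labels [(lev, i)] suffice for general position although many vertices share
    one: within a prism the labels are distinct. *)
Definition perturbed_value (t : R) lev (i : 'I_n.+1) x : 'rV[R]_n :=
  let u := vert R q x i in
  mxvec (equivariant_value lev u) + t *: (y (lev, i) *m rho R (orbit_elt u)).

Lemma rhoM b b' : rho R (b * b')%g = rho R b *m rho R b'.
Proof.
apply/row_matrixP => i; rewrite !rowE mulmxA -[delta_mx _ _]vec_mxK.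
by rewrite !mul_rho actCM.
Qed.

Definition tame_simplices : {set simplex k m} :=
  [set x | pos_inj x && `[< forall i : 'I_n.+1, tame (vert R q x i) >]]%SET.
Definition fundamental_domain (i : 'I_n.+1) : {set simplex k m} :=
  [set x in tame_simplices | orbit_rep (vert R q x i) == vert R q x i]%SET.

Lemma tame_simplicesP x : reflect (pos_inj x /\ forall i : 'I_n.+1, tame (vert R q x i)) (x \in tame_simplices).
Proof.
by rewrite inE; apply: (iffP andP) => -[h1 h2]; split=> //; [apply/asboolP | apply/asboolP].
Qed.

Lemma fundamental_domainE i x : (x \in fundamental_domain i) = (x \in tame_simplices) && (orbit_rep (vert R q x i) == vert R q x i).
Proof. by rewrite inE. Qed.

Lemma tame_simplices_tame x i : x \in tame_simplices -> (i <= n)%N -> tame (vert R q x i).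
Proof. by move=> /tame_simplicesP[_ h] i_n; exact: (h (Ordinal (i_n : (i < n.+1)%N))). Qed.

Lemma tame_simplices_act x b : x \in tame_simplices -> actS R x b \in tame_simplices.
Proof.
move=> /tame_simplicesP[h1 h2]; apply/tame_simplicesP; split=> [|i]; first exact: pos_inj_actS.
by rewrite vert_actS //; apply: tame_act.
Qed.

Lemma actSK x b : actS R (actS R x b) b^-1%g = x.
Proof. by apply: (vert_inj (R := R) q_gt0) => i _; rewrite !vert_actS // actVK. Qed.

Lemma actS_mul x b b' : actS R x (b * b')%g = actS R (actS R x b) b'.
Proof. by apply: (vert_inj (R := R) q_gt0) => i _; rewrite !vert_actS // actV_mul. Qed.

Lemma actS_one x : actS R x 1%g = x.
Proof. by apply: (vert_inj (R := R) q_gt0) => i _; rewrite !vert_actS // actV_one. Qed.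

Lemma actS_eq x x' b b' : actS R x b = actS R x' b' -> x = actS R x' (b' * b^-1)%g.
Proof. by move=> e; rewrite actS_mul -e actSK. Qed.

Lemma perturbed_value_act t lev i x b : x \in tame_simplices ->
  perturbed_value t lev i (actS R x b) = perturbed_value t lev i x *m rho R b.
Proof.
move=> xX; have tx := tame_simplices_tame xX (leq_ord i); rewrite /perturbed_value vert_actS //.
rewrite eqv_act // grp_act // rhoM mulmxDl mul_rho -scalemxAl mulmxA.
by [].
Qed.

Lemma zero_hybrid_act t j x b : x \in tame_simplices ->
  zero_in (hybrid (perturbed_value t) j (actS R x b)) <-> zero_in (hybrid (perturbed_value t) j x).
Proof.
move=> xX.
apply: (iff_trans _ (zero_in_mul (hybrid (perturbed_value t) j x) (rho_unit R b))).
by apply: eq_zero_in => i; rewrite /hybrid perturbed_value_act.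
Qed.

(** Translating a simplex until its vertex [l] is a representative maps one domain into the other;
    by freeness at the vertex of the first domain no two simplices are identified. *)
Lemma count_FD t j i l :
  #|[set x in fundamental_domain i | `[< zero_in (hybrid (perturbed_value t) j x) >]]%SET| =
  #|[set x in fundamental_domain l | `[< zero_in (hybrid (perturbed_value t) j x) >]]%SET|.
Proof.
suff le i' l' : (#|[set x in fundamental_domain i' | `[< zero_in (hybrid (perturbed_value t) j x) >]]%SET| <=
  #|[set x in fundamental_domain l' | `[< zero_in (hybrid (perturbed_value t) j x) >]]%SET|)%N.
  by apply/eqP; rewrite eqn_leq !le.
pose phi x := actS R x (orbit_elt (vert R q x l'))^-1%g.
rewrite -(@card_in_imset _ _ phi) => [|x x'].
  apply: subset_leq_card; apply/fintype.subsetP => _ /imsetP[x + ->].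
  rewrite inE fundamental_domainE => /andP[/andP[xX _] /asboolP zx].
  have pX : phi x \in tame_simplices by exact: tame_simplices_act.
  rewrite inE fundamental_domainE pX /=; apply/andP; split.
    by rewrite /phi vert_actS // rep_act -[X in act X _](grpP (vert R q x l')) actVK.
  by apply/asboolP/zero_hybrid_act.
rewrite inE fundamental_domainE => /andP[/andP[xX /eqP rx] _].
rewrite inE fundamental_domainE => /andP[/andP[x'X /eqP rx'] _].
move=> /actS_eq ex.
move: rx; rewrite ex vert_actS // rep_act rx' => /esym/tame_free h.
rewrite h; last by apply: tame_simplices_tame; rewrite ?leq_ord.
by rewrite actS_one.
Qed.

Lemma mesh x i j : close_mx q%:R^-1 (vert R q x i) (vert R q x j).
Proof.
move=> a l; apply: le_lt_trans (vert_dist _ _ _ _ _ _ _) _ => //.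
by rewrite ltf_pV2 ?posrE ?ltr0n ?muln_gt0 // ltr_nat -[X in (X < _)%N]mul1n ltn_pmul2r.
Qed.

Lemma perturbed_value_pivot t lev (i j : 'I_n.+1) x : x \in tame_simplices -> j != i ->
  perturbed_value t lev j (pivot i x) = perturbed_value t lev j x.
Proof.
move=> xX ji; rewrite /perturbed_value vert_pivot ?leq_ord //.
by move=> a l; apply: tame_lt2; apply: tame_simplices_tame; rewrite ?leq_ord.
Qed.

Lemma near_prism_generic : \forall t \near 0^'+,
  forall x, x \in tame_simplices -> forall i : 'I_n.+1, generic (prism (perturbed_value t) i x).
Proof.
apply: filter_forall => x; apply: near_imp => xX; apply: filter_forall => i.
pose lab (a : 'I_n.+2) := ((a <= i)%N, pos_of i a).
have labI : injective lab.
  move=> a a' [e1 /(congr1 (@nat_of_ord _))]; rewrite !pos_ofE /unbump => e2.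
  by apply: ord_inj; move: e1 e2; lia.
pose g a := orbit_elt (vert R q x (pos_of i a)).
apply: (near_generic (fun a => mxvec (equivariant_value (lab a).1 (vert R q x (lab a).2)))
  (w := fun a => y (lab a) *m rho R (g a))) => h hI.
exact: (y_generic (g \o h) (inj_comp labI hI)).
Qed.

(** The new vertex has a Gram defect of size at least [c], so by the mesh bound the others have the
    same entry beyond [c / 2] with the same sign. This keeps them away from the orbit of [1], where
    the defect is below [c / 2]; so on and above the diagonal both levels have the value [gram1]. *)
Lemma pivot_out x (i : 'I_n.+1) : x \in tame_simplices -> pivot i x \notin tame_simplices ->
  exists (a l : 'I_k) (s : R), (a <= l)%N /\ forall j : 'I_n.+1, j != i -> forall lev,
    0 < s * equivariant_value lev (vert R q x j) a l.
Proof.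
move=> xX nX.
have vE (j : 'I_n.+1) : j != i -> vert R q (pivot i x) j = vert R q x j.
  move=> ji; rewrite vert_pivot ?leq_ord //.
  by move=> a l; apply: tame_lt2; apply: tame_simplices_tame; rewrite ?leq_ord.
set z := vert R q (pivot i x) i.
have [a0 [l0 zal]] : exists a l, c <= `|gram1 z a l|.
  apply: contrapT => h; case/negP: nX; apply/tame_simplicesP; split.
    by apply: pos_inj_pivot; have /tame_simplicesP[] := xX.
  move=> j; have [->|ji] := eqVneq j i; last first.
    by rewrite vE //; apply: tame_simplices_tame; rewrite ?leq_ord.
  move=> a l; rewrite mx0E subr0 ltNge; apply/negP => hh; apply: h; by exists a, l.
have [a [l [weight_le zc]]] : exists a l : 'I_k, (a <= l)%N /\ c <= `|gram1 z a l|.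
  case: (leqP a0 l0) => al0; first by exists a0, l0.
  by exists l0, a0; split; [exact: ltnW | rewrite -[gram1 z]gram1_sym mxE].
exists a, l, (gram1 z a l); split=> // j ji lev.
set u := vert R q x j.
have tu : tame u by apply: tame_simplices_tame; rewrite ?leq_ord.
have uz : close_mx q%:R^-1 u z by rewrite /u -vE //; exact: mesh.
have u2 : bounded_by 2 u by move=> ? ?; rewrite ltW // tame_lt2.
have u3 : bounded_by 3 u by move=> ? ?; apply: le_trans (u2 _ _) _; lra.
have q1 : q%:R^-1 <= 1 :> R by apply: le_trans q_rh _; apply: le_trans rh_small _; lra.
have z3 : bounded_by 3 z.
  by move=> ? ?; apply: le_trans (bounded_close u2 uz _ _) _; lra.
have guz := gram_mesh u3 z3 uz.
have -> : equivariant_value lev u a l = gram1 u a l.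
  case: lev; first by have [v [_ _ ->]] := eqv_true tu; rewrite mxE weight_le.
  rewrite eqv_far ?mxE ?weight_le // => b ub.
  have : close_mx (2 * rh) (act u b) 1%:M by apply: close_mxW ub; move: rh_gt0; lra.
  move=> /gram_ball h.
  have : close_mx (c / 2) (gram1 u) 0.
    move=> a' l'; have := h ((perm_part b) a') ((perm_part b) l').
    rewrite !mx0E !subr0 gram1_actV [conjB _ _ _ _]mxE !normrM !norm_eps !mul1r.
    by rewrite /iperm !permK.
  move=> /(_ a l); rewrite mx0E subr0 => h1; have := guz a l => h2.
  have := ler_distD (gram1 u a l) (gram1 z a l) 0; rewrite !subr0 distrC => h3.
  by move: zc h1 h2 h3; lra.
by apply: same_sign; apply: lt_le_trans (guz a l) _; move: zc c_gt0; lra.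
Qed.

Lemma near_prism_boundary : \forall t \near 0^'+,
  forall x, x \in tame_simplices -> forall (i : 'I_n.+1) (a : 'I_n.+2), pos_of i a != i ->
  pivot (pos_of i a) x \notin tame_simplices -> ~ zero_in (fun j => prism (perturbed_value t) i x (lift a j)).
Proof.
apply: filter_forall => x; apply: near_imp => xX.
apply: filter_forall => i; apply: filter_forall => a; apply: near_imp => ai.
apply: near_imp => nX; have [a0 [l0 [s [_ sP]]]] := pivot_out xX nX.
pose lev (j : 'I_n.+1) := (lift a j <= i)%N; pose p j := pos_of i (lift a j).
apply: (@near_not_zero_in _ _ _ (fun j => mxvec (equivariant_value (lev j) (vert R q x (p j))))
   (fun j => y (lev j, p j) *m rho R (orbit_elt (vert R q x (p j))))).
apply: (positive_on_entry (a := a0) (c := l0) (s := s)) => j.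
by apply: sP; exact: pos_of_lift.
Qed.

Lemma near_true : \forall t \near 0^'+,
  forall x, x \in tame_simplices -> ~ zero_in (fun i => perturbed_value t true i x).
Proof.
apply: filter_forall => x; apply: near_imp => xX.
apply: near_not_zero_in.
have tx i : (i <= n)%N -> tame (vert R q x i) by exact: tame_simplices_tame.
have [v [Vv vx _]] := eqv_true (tx 0 (leq0n _)).
have [i [j [s [ji sP]]]] := f_sign Vv.
apply: (positive_on_entry (a := i) (c := j) (s := s)) => l.
have [w [Vw wx ->]] := eqv_true (tx l (leq_ord l)).
rewrite mxE leqNgt ji /=; apply: sP => //.
(* The two orthonormal bases are within [rv + 1/q + rv], hence within the [3 rv] of [f_sign]. *)
have h := close_trans (close_trans vx (mesh x 0 l)) (close_sym wx).
by apply: close_mxW h; move: q_rv; lra.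
Qed.

Let q_le_m : (q <= m)%N. Proof. by rewrite -[X in (X <= _)%N]mul1n leq_mul2r orbT. Qed.

Let q2_lt : (2 * q)%:R^-1 < q%:R^-1 :> R.
Proof.
by rewrite ltf_pV2 ?posrE ?ltr0n ?muln_gt0 // ltr_nat -[X in (X < _)%N]mul1n ltn_pmul2r.
Qed.

Local Notation std0 := (std k m q).

Lemma std_near1 i : near1 (vert R q std0 i).
Proof.
move=> a l; rewrite vert_std // [1%:M a l]mxE addrAC subrr add0r.
apply: le_lt_trans (lt_le_trans q2_lt q_rh).
rewrite normrM normfV !ger0_norm ?ler0n // -[leRHS]mul1r ler_wpM2r ?invr_ge0 ?ler0n //.
by case: (_ < i)%N.
Qed.

Lemma barycenter_near1 : close_mx q%:R^-1 (barycenter R k m q) 1%:M.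
Proof.
move=> a l; rewrite barycenterE // [1%:M a l]mxE addrAC subrr add0r.
apply: le_lt_trans q2_lt.
rewrite normrM normfV [`|_%:R|]ger0_norm ?ler0n // -[leRHS]mul1r.
rewrite ler_wpM2r ?invr_ge0 ?ler0n //.
by rewrite gtr0_norm ?theta_gt0 // ltW // theta_lt1.
Qed.

Lemma tame_simplices_std : std0 \in tame_simplices.
Proof.
apply/tame_simplicesP; split=> [|i]; last by apply: near1_tame; exact: std_near1.
apply/injectiveP => -[a l] [a' l'] /=; rewrite !mxE /= /mxvec_index.
by move=> /cast_ord_inj/enum_rank_inj.
Qed.

(** If all vertices are near [1], the values come from one invertible linear map and the functional
    separating the barycenter is pulled back. Otherwise some vertex is outside the
    [rh]-neighbourhood while all are within [2 rh], and [quad_lin_mesh] handles the mixture of [lin]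
    and [quad]. *)
Lemma eqv_positive x i : x \in tame_simplices -> (forall b, x != actS R std0 b) ->
  near1 (vert R q x i) -> (i <= n)%N ->
  positive_on (fun j : 'I_n.+1 => mxvec (equivariant_value false (vert R q x j))).
Proof.
move=> xX nx near_i i_n.
have [allnear|/existsNP[j nj]] := pselect (forall j : 'I_n.+1, near1 (vert R q x j)).
  have [xI _] := tame_simplicesP _ xX.
  have xne : x != std0 by have := nx 1%g; rewrite actS_one.
  have [chi chiP] := separate_barycenter R q_gt0 q_le_m xI xne.
  exists (invmx (lin_mat R k) *m chi) => j.
  rewrite eqv_near // -mul_lin_mat -mulmxA mulKVmx ?lin_mat_unit //.
  by apply: chiP; rewrite leq_ord.
set v := vert R q x j in nj.
have close_v a : close_mx (2 * rh) (vert R q x a) 1%:M.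
  have := close_trans (mesh x a i) near_i; apply: close_mxW.
  by move: q_rh; lra.
have [|a [l [s sP]]] := quad_lin_mesh _ (close_v j).
  apply: contrapT => h; apply: nj => a l; rewrite [1%:M a l]mxE ltNge; apply/negP => hh.
  by apply: h; exists a, l; apply: le_trans hh; move: rh_gt0; lra.
apply: (positive_on_entry (a := a) (c := l) (s := s)) => p.
have [quad_p lin_p] := sP _ (mesh x j p).
have [np|np] := pselect (near1 (vert R q x p)).
  by rewrite eqv_near //; apply: lin_p; exact: barycenter_near1.
rewrite eqv_far // => b nb; apply: np.
(* The neighbourhoods of the orbit points of [1] are disjoint even at radius [1/2], so a vertex
   within [2 rh] of [1] cannot be near another orbit point. *)
suff b1 : b = 1%g by rewrite b1 actV_one in nb.
apply: (@close1_free (vert R q x p)).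
  by apply: close_mxW (close_v p); move: rh_small; lra.
by apply: close_mxW nb; move: rh_small; lra.
Qed.

Lemma near_false : \forall t \near 0^'+,
  forall x, x \in tame_simplices -> (forall b, x != actS R std0 b) ->
  ~ zero_in (fun i => perturbed_value t false i x).
Proof.
apply: filter_forall => x; apply: near_imp => xX; apply: near_imp => nx.
apply: near_not_zero_in.
have [[i [b nb]]|far] := pselect (exists (i : 'I_n.+1) b, near1 (act (vert R q x i) b)).
  have := @eqv_positive (actS R x b) i (tame_simplices_act b xX).
  rewrite vert_actS // => /(_ _ nb (leq_ord i)) h.
  have {h} := positive_on_mul (rho_unit R b^-1%g) (h _).
  have -> : (fun j : 'I_n.+1 => mxvec (equivariant_value false (vert R q (actS R x b) j)) *m rho R b^-1) =
      (fun j : 'I_n.+1 => mxvec (equivariant_value false (vert R q x j))).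
    apply/funext => j; have tj := tame_simplices_tame xX (leq_ord j).
    by rewrite vert_actS // eqv_act // mul_rho -actCM mulgV actC1.
  apply=> b'; apply: contra (nx (b' * b^-1)%g) => /eqP e.
  by rewrite actS_mul -e actSK.
(* Away from the orbit of [1] all values are those of [quad], which has an entry of size at least
   [ka] and varies by less than [ka] on the simplex. *)
have farE (i : 'I_n.+1) : equivariant_value false (vert R q x i) = quad (vert R q x i).
  by apply: eqv_far => b nb; apply: far; exists i, b.
have u2 i : (i <= n)%N -> bounded_by 2 (vert R q x i).
  by move=> i_n a l; rewrite ltW // tame_lt2 //; apply: tame_simplices_tame.
have u3 i : (i <= n)%N -> bounded_by 3 (vert R q x i).
  by move=> i_n a l; apply: le_trans (u2 i i_n a l) _; lra.
have [|a [l al_ka]] := quad_away (u2 0 (leq0n n)).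
  by move=> b nb; apply: far; exists ord0, b.
apply: (positive_on_entry (a := a) (c := l) (s := quad (vert R q x 0) a l)) => i.
rewrite farE; apply: same_sign; rewrite distrC; apply: lt_le_trans al_ka.
by apply: quad_mesh; [exact: u3 | apply: u3; exact: leq_ord | exact: mesh].
Qed.

Lemma near_std : \forall t \near 0^'+, zero_in (fun i => perturbed_value t false i std0).
Proof.
have E t i : perturbed_value t false i std0 =
    mxvec (vert R q std0 i - barycenter R k m q) *m lin_mat R k +
      t *: (y (false, i) *m rho R (orbit_elt (vert R q std0 i))).
  by rewrite /perturbed_value eqv_near ?mul_lin_mat //; exact: std_near1.
have {}E t : (fun i => perturbed_value t false i std0) = (fun i : 'I_n.+1 =>
    mxvec (vert R q std0 i - barycenter R k m q) *m lin_mat R k +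
      t *: (y (false, i) *m rho R (orbit_elt (vert R q std0 i)))).
  by apply/funext => i; exact: E.
under eq_near do rewrite E.
apply: near_zero_in.
  by rewrite -mulmx_suml sum_std mul0mx.
pose w (i : 'I_n) := mxvec (vert R q std0 (lift ord0 i) - barycenter R k m q).
have -> : \matrix_i (w i *m lin_mat R k) = (\matrix_i w i) *m lin_mat R k.
  by apply/row_matrixP => i; rewrite row_mul !rowK.
rewrite det_mulmx mulf_neq0 ?det_std //.
by have := lin_mat_unit R k; rewrite unitmxE unitfE.
Qed.

Lemma model_contradiction : False.
Proof.
have FF : ProperFilter ((0 : R)^'+) by exact: at_right_proper_filter.
have H : \forall t \near (0 : R)^'+,
  (((forall x, x \in tame_simplices -> forall i : 'I_n.+1, generic (prism (perturbed_value t) i x)) /\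
  (forall x, x \in tame_simplices -> forall (i : 'I_n.+1) (a : 'I_n.+2), pos_of i a != i ->
    pivot (pos_of i a) x \notin tame_simplices -> ~ zero_in (fun j => prism (perturbed_value t) i x (lift a j)))) /\
  (forall x, x \in tame_simplices -> ~ zero_in (fun i => perturbed_value t true i x))) /\
  ((forall x, x \in tame_simplices -> (forall b, x != actS R std0 b) ->
    ~ zero_in (fun i => perturbed_value t false i x)) /\ zero_in (fun i => perturbed_value t false i std0)).
  have F1 := near_prism_generic; have F2 := near_prism_boundary.
  have F3 := near_true; have F4 := near_false; have F5 := near_std.
  by near=> t; do ![split]; near: t.
have [t Ht] := @filter_ex _ _ FF _ H.
case: Ht => -[[gen bnd] tr] [fa st].
have : odd #|[set x in fundamental_domain ord0 | `[< zero_in (fun i => perturbed_value t false i x) >]]%SET| =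
    odd #|[set x in fundamental_domain ord0 | `[< zero_in (fun i => perturbed_value t true i x) >]]%SET|.
  apply: (@odd_zero_count R n _ tame_simplices fundamental_domain (fun i => pivot i) (perturbed_value t)).
  - by move=> i x; rewrite fundamental_domainE => /andP[].
  - by move=> i x _; apply: pivotK; rewrite leq_ord.
  - move=> i x xX.
    have xI: pos_inj x by case/tame_simplicesP: xX.
    exact: pivot_neq k_gt0 (leq_ord i) xI.
  - by move=> lev i j x xX ji; exact: perturbed_value_pivot.
  - move=> i j x ij nX; rewrite !fundamental_domainE nX => /andP[xX].
    rewrite vert_pivot ?leq_ord //.
    by move=> a l; apply: tame_lt2; apply: tame_simplices_tame; rewrite ?leq_ord.
  - by move=> i x xX; exact: gen.
  - by move=> i x a xX; exact: bnd.
  - by move=> j i l; exact: count_FD.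
(* Of the translates of [std0] only [std0] itself has a representative as first vertex, since points
   near [1] represent their orbits. *)
have -> : [set x in fundamental_domain ord0 | `[< zero_in (fun i => perturbed_value t false i x) >]]%SET =
    [set std0]%SET.
  apply/setP => x; rewrite inE finset.in_set1 fundamental_domainE; apply/idP/eqP => [|->].
    move=> /andP[/andP[xX /eqP rx] /asboolP zx].
    have [b Ex] : exists b, x = actS R std0 b.
      apply: contrapT => /forallNP h; apply: (fa x xX _ zx) => b.
      by apply/eqP; exact: h.
    move: rx; rewrite Ex vert_actS // rep_act rep_near1; last exact: std_near1.
    move=> /esym/tame_free -> //; last by apply: near1_tame; exact: std_near1.
    by rewrite actS_one.
  rewrite tame_simplices_std rep_near1 ?eqxx /=; last exact: std_near1.
  exact/asboolP.
have -> : [set x in fundamental_domain ord0 | `[< zero_in (fun i => perturbed_value t true i x) >]]%SET =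
    finset.set0.
  apply/setP => x; rewrite inE finset.in_set0 fundamental_domainE; apply/negP.
  move=> /andP[/andP[xX _] /asboolP].
  exact: tr.
by rewrite finset.cards1 finset.cards0.
Unshelve. all: by end_near.
Qed.

End WithFamily.
End Model.

(** * Choice of the constants and conclusion *)

Lemma inv_nat_lt (R : realType) (e : R) : 0 < e ->
  exists2 q : nat, (0 < q)%N & q%:R^-1 < e.
Proof.
move=> e0; have ie0 : 0 < e^-1 by rewrite invr_gt0.
have h := archi_boundP (ltW ie0); exists (Num.bound e^-1).
  by rewrite -(ltr_nat R); apply: lt_trans ie0 h.
by rewrite invf_plt ?posrE // (lt_trans ie0 h).
Qed.

Theorem corollary1p2 (R : realType) (k : nat) (k_gt0 : (0 < k)%N)
  (f : 'M[R]_k -> W2p R k)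
  (f_cont : {within V_ R k, continuous f})
  (f_equiv : forall (u : 'M[R]_k) (b : B_ k),
     V_ R k u -> f (actV R k u b) = actW R k (f u) b) :
  exists2 u : 'M[R]_k, V_ R k u & f u = 0.
Proof.
apply: contrapT => nozero.
have f0 u : V_ R k u -> f u != 0.
  by move=> Vu; apply/eqP => fu; apply: nozero; exists u.
have [e e0 eP] := target_sign f_cont f0.
have e3 : 0 < e / 3 by rewrite divr_gt0.
have [c1 c10 c1P] := @near_V R k _ e3.
pose c := Num.min c1 (1 / 2); have c0 : 0 < c by rewrite lt_min c10 divr_gt0.
have c12 : c <= 1 / 2 by rewrite ge_min lexx orbT.
have cc1 : c <= c1 by rewrite ge_min lexx.
have [C C0 CP] := gram1_lip k (3 : R).
have [r0 r00 r0P] := quad_lin_sign R k.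
(* The bound [1 / 8] keeps balls around orbit points disjoint, [r0 / 2] admits [quad_lin_sign], and
   [c / (8 C)] keeps the Gram defect below [c / 2] on the ball of radius [2 rh]. *)
pose rh := Num.min (1 / 8) (Num.min (r0 / 2) (c / (8 * C))).
have rh0 : 0 < rh by rewrite !lt_min !divr_gt0 // mulr_gt0.
have rh8 : rh <= 1 / 8 by rewrite ge_min lexx.
have rh_r0 : rh < r0.
  apply: (@le_lt_trans _ _ (r0 / 2)); first by rewrite !ge_min lexx orbT.
  by rewrite ltr_pdivrMr // ltr_pMr // ltr1n.
have rhC : C * (2 * rh) <= c / 4.
  have : rh <= c / (8 * C) by rewrite !ge_min lexx !orbT.
  rewrite -(ler_pM2l (_ : 0 < 2 * C)) ?mulr_gt0 //.
  rewrite (_ : 2 * C * (c / (8 * C)) = c / 4); last by field; rewrite gt_eqF.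
  by rewrite mulrA [C * 2]mulrC.
clearbody rh c.
have [ka ka0 kaP] := @quad_far R k rh rh0.
have [d0 d00 d0P] := r0P rh (introT andP (conj rh0 rh_r0)).
have [C2 C20 C2P] := quad_lip k (3 : R).
(* The mesh [1/q] must be below [rv] and [rh], change [gram1] by less than [c / 2] and [quad] by
   less than [ka], and be admissible as [d] in [quad_lin_sign]. *)
pose bound := Num.min (e / 3) (Num.min rh (Num.min (c / (2 * C)) (Num.min (ka / C2) d0))).
have bound0 : 0 < bound.
  by rewrite !lt_min; do ![apply/andP; split=> //]; rewrite divr_gt0 // mulr_gt0.
have [q q0] := inv_nat_lt bound0; rewrite !lt_min => /and5P[q1 q2 q3 q4 q5].
have iq0 : 0 < q%:R^-1 :> R by rewrite invr_gt0 ltr0n.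
have [y yP] := det_family (@rho_unit R k) (bool * 'I_(k * k).+1)%type.
apply: (@model_contradiction R k f k_gt0 f_equiv c (e / 3) rh ka q
  _ _ _ _ _ _ _ _ _ _ _ _ _ _ y yP) => //.
- by move=> v vc; apply: c1P; apply: close_mxW vc.
- move=> u Vu; have [i [j [s [ji sP]]]] := eP u Vu; exists i, j, s; split=> // u' Vu' uu'.
  by apply: sP => //; apply: close_mxW uu'; lra.
- move=> v v1; have one3 : bounded_by 3 (1%:M : 'M[R]_k).
    move=> a l; rewrite mxE.
    by case: (a == l); rewrite ?mulr1n ?mulr0n ?normr1 ?normr0; lra.
  have one1 : bounded_by 1 (1%:M : 'M[R]_k).
    move=> a l; rewrite mxE.
    by case: (a == l); rewrite ?mulr1n ?mulr0n ?normr1 ?normr0; lra.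
  have v3 : bounded_by 3 v.
    by move=> a l; apply: le_trans (bounded_close one1 (close_sym v1) a l) _; lra.
  have g1 : gram1 (1%:M : 'M[R]_k) = 0.
    by rewrite /gram1 qformE trmx1 mulmx1 mul1mx; apply/matrixP => i j; rewrite !mxE subrr.
  have rh2 : 0 < 2 * rh by rewrite mulr_gt0.
  rewrite -g1; apply: close_mxW (CP _ _ _ rh2 v3 one3 v1).
  by apply: le_trans rhC _; lra.
- exact: ltW.
- exact: ltW.
- move=> u v u3 v3 uv; apply: close_mxW (CP _ _ _ iq0 u3 v3 uv).
  rewrite ltW // (_ : c / 2 = C * (c / (2 * C))); last by field; rewrite gt_eqF.
  by rewrite ltr_pM2l.
- move=> u v u3 v3 uv; apply: close_mxW (C2P _ _ _ iq0 u3 v3 uv).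
  by rewrite ltW // mulrC -ltr_pdivlMr.
- by move=> v va v1; apply: (d0P q%:R^-1) => //; rewrite iq0 q5.
Qed.
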